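(* Let $\bar A\in\mathbb{R}^{m\times n}$ and let $\mathcal{U}$ be a nonempty, compact and convex subset of $\mathbb{R}_{++}\times\mathbb{R}^m$. Then $S$ is Lipschitz continuous on $\mathcal{U}\times\mathcal{V}$ for some neighborhood $\mathcal{V}$ of $\bar A$ if and only if for all $(\lambda,b)\in\mathcal{U}$ the following condition (Condition 1.2 at $(\lambda,b,\bar A)$) holds: there is some $x\in S(\lambda,b,\bar A)$ such that the columns $\bar A_i$ of $\bar A$ with $i\in\{1,\dots,n\}$ satisfying $|\bar A_i^\top(b-\bar Ax)|=\lambda$ are linearly independent.
   Context: Notation: $\mathbb{R}_{++}=(0,\infty)$; $\|\cdot\|$ is the Euclidean norm (the spectral norm for matrices), $\|\cdot\|_1$ the $\ell_1$-norm; $A_i$ is the $i$th column of $A$; $\operatorname{rge}A$ is the range of $A$ and $\operatorname{proj}_{\operatorname{rge}A}b$ is the Euclidean projection of $b$ onto $\operatorname{rge}A$; $\mathbb{B}$ is the closed unit Euclidean ball. Solution multifunction $S:\mathbb{R}\times\mathbb{R}^m\times\mathbb{R}^{m\times n}\rightrightarrows\mathbb{R}^n$: if $\lambda>0$, $S(\lambda,b,A)$ is the set of minimizers over $x\in\mathbb{R}^n$ of $\frac{1}{2\lambda}\|Ax-\operatorname{proj}_{\operatorname{rge}A}b\|^2+\|x\|_1$ (equivalently of the Lasso objective $\frac12\|Ax-b\|^2+\lambda\|x\|_1$); if $\lambda=0$, $S(0,b,A)$ is the set of minimizers of $\|x\|_1$ subject to $Ax=\operatorname{proj}_{\operatorname{rge}A}b$;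 if $\lambda<0$, $S(\lambda,b,A)=\emptyset$. A multifunction $G$ is Lipschitz continuous on a set $X$ if $G(x)$ is nonempty and closed for every $x\in X$ and there is $\kappa\ge 0$ with $G(x')\subset G(x)+\kappa\|x'-x\|\mathbb{B}$ for all $x,x'\in X$. *)

(* Defs.v *)
From mathcomp Require Import all_boot all_order all_algebra.
From mathcomp Require Import all_classical all_reals all_analysis.

Set Implicit Arguments.
Unset Strict Implicit.
Unset Printing Implicit Defensive.

Import Order.TTheory GRing.Theory Num.Theory.
Import numFieldNormedType.Exports.

Local Open Scope classical_set_scope.
Local Open Scope ring_scope.

(* The library's norm on matrices (and column vectors) is the maximum norm,
   hence the explicit norms below.  The library's topology on matrices is the
   one these norms induce. *)
Definition l2norm (R : realType) (n : nat) (x : 'cV[R]_n) : R :=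
  Num.sqrt (\sum_(i < n) x i 0 ^+ 2).

Definition l1norm (R : realType) (n : nat) (x : 'cV[R]_n) : R :=
  \sum_(i < n) `|x i 0|.

Definition l2ball (R : realType) (n : nat) : set 'cV[R]_n :=
  [set x | l2norm x <= 1].
Arguments l2ball : clear implicits.

Definition spectral_norm (R : realType) (m n : nat) (A : 'M[R]_(m, n)) : R :=
  sup [set l2norm (A *m x) | x in l2ball R n].

(* The parameter space R x R^m x R^(m x n).  R^o is R seen as a vector space
   over itself. *)
Definition param (R : realType) (m n : nat) : Type :=
  (R^o * 'cV[R]_m * 'M[R]_(m, n))%type.

Definition param_dist (R : realType) (m n : nat) (p q : param R m n) : R :=
  Num.sqrt ((p.1.1 - q.1.1) ^+ 2 + l2norm (p.1.2 - q.1.2) ^+ 2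
            + spectral_norm (p.2 - q.2) ^+ 2).

Definition minimizers (R : realType) (T : Type) (f : T -> R) (C : set T) :
    set T :=
  [set x | C x /\ forall y, C y -> f x <= f y].

Definition rge (R : realType) (m n : nat) (A : 'M[R]_(m, n)) : set 'cV[R]_m :=
  range (fun x : 'cV[R]_n => A *m x).

(* The default value 0 is only returned when C has no point nearest to b, which
   does not happen when C is the range of a matrix. *)
Definition euclidean_proj (R : realType) (m : nat) (C : set 'cV[R]_m) (b : 'cV[R]_m) :
    'cV[R]_m :=
  xget 0 (minimizers (fun y => l2norm (y - b)) C).

Definition lasso_solutions (R : realType) (m n : nat) (p : param R m n) :
    set 'cV[R]_n :=
  let: (lambda, b, A) := p in
  if 0 < lambda then
    minimizers (fun x : 'cV[R]_n =>
      (2 * lambda)^-1 * l2norm (A *m x - euclidean_proj (rge A) b) ^+ 2 + l1norm x) setT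
  else if lambda == 0 then
    minimizers (@l1norm R n) [set x | A *m x = euclidean_proj (rge A) b]
  else set0.

Definition lipschitz_multifunction (R : realType) (T : Type) (n : nat)
    (dist : T -> T -> R) (G : T -> set 'cV[R]_n) (X : set T) : Prop :=
  (forall x, X x -> G x !=set0 /\ closed (G x)) /\
  exists2 kappa : R, 0 <= kappa &
    forall x x', X x -> X x' ->
      G x' `<=` [set y + (kappa * dist x' x) *: z | y in G x & z in l2ball R n].

(* [free] applies to the family of columns: a repeated column makes it
   linearly dependent. *)
Definition condition12 (R : realType) (m n : nat) (lambda : R) (b : 'cV[R]_m)
    (A : 'M[R]_(m, n)) : Prop :=
  exists2 x : 'cV[R]_n, lasso_solutions (lambda, b, A) x &
    free [seq col i A | i <- enum 'I_n
                      & `|((col i A)^T *m (b - A *m x)) 0 0| == lambda].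

(* Main.v *)
Require Import Defs.
From mathcomp Require Import all_boot all_order all_algebra.
From mathcomp Require Import all_classical all_reals all_analysis.
From mathcomp Require Import ring lra.

Import Order.TTheory GRing.Theory Num.Theory.
Import numFieldNormedType.Exports.

Local Open Scope classical_set_scope.
Local Open Scope ring_scope.

Set Implicit Arguments.
Unset Strict Implicit.
Unset Printing Implicit Defensive.

(** Write [g := A^T (b - A x)] for the correlations of the columns with the
    residual. By Fermat's rule, [x] solves the Lasso problem if and only if
    every [g i] has modulus at most [lambda] and equals [lambda] times the sign
    of [x i] when [x i] is not zero ([lasso_solutionsP]). In particular,
    solutions are supported on the active columns, those with
    [|g i| = lambda].

    The condition implies Lipschitz continuity. Subtracting the optimality
    conditions at two parameters at distance [D], and testing against the
    difference [z] of the solutions, gives [|A z|^2 <= C D |z|] by monotonicity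
    of the subdifferential of the l1-norm ([fit_gap]). Hence the fit [A x], and
    with it [g], depends continuously on the parameter, so that near a given
    parameter all solutions are supported on the columns active there
    ([support_stable]). Those columns being independent, [|z|] is bounded by a
    multiple of [|A z|], and the estimate becomes [|z| <= k D]
    ([local_lipschitz]). Compactness of the set [U `*` U] of pairs of
    parameters then gives one constant and one neighbourhood of [Abar]
    ([uniform_lipschitz]).

    Conversely, suppose that at some [(lambda, b)] the active columns satisfy a
    non-trivial relation [A w = 0]. Moving every active coordinate of a
    solution in the direction of its correlation, and moving [b] so as to keep
    the residual, yields a solution that is non-zero at all active columns.
    Adding multiples of [w] to it gives a segment of solutions, one end of which
    vanishes at a coordinate [i] ([kkt_shift], [kkt_slide]). As only the matrix
    may be perturbed, the motion of [b] is undone by a rotation and a scaling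
    close to the identity ([kkt_similarity]), so non-uniqueness occurs for
    matrices arbitrarily close to [Abar]. Where it occurs, a tilt of column [i]
    against the residual, as small as desired, forces [x i = 0] for all
    solutions, so the solution set jumps ([not_lipschitz_of_slide]). *)

(** * Inner product and crude norm bounds *)

Definition dot (R : realType) (n : nat) (u v : 'cV[R]_n) : R := (u^T *m v) 0 0.

Lemma dotE (R : realType) (n : nat) (u v : 'cV[R]_n) :
  dot u v = \sum_(i < n) u i 0 * v i 0.
Proof. by rewrite /dot mxE; apply: eq_bigr => i _; rewrite mxE. Qed.

Lemma dotC (R : realType) (n : nat) (u v : 'cV[R]_n) : dot u v = dot v u.
Proof. by rewrite !dotE; apply: eq_bigr => i _; rewrite mulrC. Qed.

Lemma dotDr (R : realType) (n : nat) (u v w : 'cV[R]_n) :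
  dot u (v + w) = dot u v + dot u w.
Proof. by rewrite /dot mulmxDr mxE. Qed.

Lemma dotNr (R : realType) (n : nat) (u v : 'cV[R]_n) : dot u (- v) = - dot u v.
Proof. by rewrite /dot mulmxN mxE. Qed.

Lemma dotBr (R : realType) (n : nat) (u v w : 'cV[R]_n) :
  dot u (v - w) = dot u v - dot u w.
Proof. by rewrite dotDr dotNr. Qed.

Lemma dotZr (R : realType) (n : nat) (a : R) (u v : 'cV[R]_n) :
  dot u (a *: v) = a * dot u v.
Proof. by rewrite /dot -scalemxAr mxE. Qed.

Lemma dotDl (R : realType) (n : nat) (u v w : 'cV[R]_n) :
  dot (u + v) w = dot u w + dot v w.
Proof. by rewrite !(dotC _ w) dotDr. Qed.

Lemma dotNl (R : realType) (n : nat) (u v : 'cV[R]_n) : dot (- u) v = - dot u v.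
Proof. by rewrite !(dotC _ v) dotNr. Qed.

Lemma dotBl (R : realType) (n : nat) (u v w : 'cV[R]_n) :
  dot (u - v) w = dot u w - dot v w.
Proof. by rewrite !(dotC _ w) dotBr. Qed.

Lemma dotZl (R : realType) (n : nat) (a : R) (u v : 'cV[R]_n) :
  dot (a *: u) v = a * dot u v.
Proof. by rewrite !(dotC _ v) dotZr. Qed.

Lemma dot0r (R : realType) (n : nat) (u : 'cV[R]_n) : dot u 0 = 0.
Proof. by rewrite /dot mulmx0 mxE. Qed.

Lemma dot_trmx (R : realType) (m n : nat) (A : 'M[R]_(m, n)) u v :
  dot (A^T *m u) v = dot u (A *m v).
Proof. by rewrite /dot trmx_mul trmxK mulmxA. Qed.

Lemma dot_ge0 (R : realType) (n : nat) (u : 'cV[R]_n) : 0 <= dot u u.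
Proof. by rewrite dotE sumr_ge0 // => i _; rewrite -expr2 sqr_ge0. Qed.

Lemma dot_eq0 (R : realType) (n : nat) (u : 'cV[R]_n) : dot u u = 0 -> u = 0.
Proof.
rewrite dotE => /eqP; rewrite psumr_eq0 => [/allP u0|i _]; last first.
  by rewrite -expr2 sqr_ge0.
apply/colP => i; rewrite mxE; apply/eqP.
by have := u0 i (mem_index_enum i); rewrite mulf_eq0 orbb.
Qed.

Lemma l2norm_ge0 (R : realType) (n : nat) (u : 'cV[R]_n) : 0 <= l2norm u.
Proof. exact: sqrtr_ge0. Qed.

Lemma l2norm_sqr (R : realType) (n : nat) (u : 'cV[R]_n) :
  l2norm u ^+ 2 = dot u u.
Proof.
rewrite /l2norm sqr_sqrtr ?dotE; last by apply: sumr_ge0 => i _; rewrite sqr_ge0.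
by apply: eq_bigr => i _; rewrite expr2.
Qed.

Lemma l1norm_ge0 (R : realType) (n : nat) (u : 'cV[R]_n) : 0 <= l1norm u.
Proof. by apply: sumr_ge0 => i _. Qed.

Lemma l1normD (R : realType) (n : nat) (u v : 'cV[R]_n) :
  l1norm (u + v) <= l1norm u + l1norm v.
Proof.
by rewrite /l1norm -big_split /=; apply: ler_sum => i _; rewrite mxE ler_normD.
Qed.

Lemma l1normN (R : realType) (n : nat) (u : 'cV[R]_n) : l1norm (- u) = l1norm u.
Proof. by apply: eq_bigr => i _; rewrite mxE normrN. Qed.

Lemma entry_le_l1norm (R : realType) (n : nat) (u : 'cV[R]_n) i :
  `|u i 0| <= l1norm u.
Proof. by rewrite /l1norm (bigD1 i) //= lerDl sumr_ge0. Qed.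

Lemma entry_le_l2norm (R : realType) (n : nat) (u : 'cV[R]_n) i :
  `|u i 0| <= l2norm u.
Proof.
rewrite -[leRHS]ger0_norm ?l2norm_ge0 // -ler_sqr ?nnegrE // !real_normK ?num_real //.
rewrite l2norm_sqr dotE (bigD1 i) //= -expr2 lerDl.
by apply: sumr_ge0 => j _; rewrite -expr2 sqr_ge0.
Qed.

Lemma l2norm_le_l1norm (R : realType) (n : nat) (u : 'cV[R]_n) :
  l2norm u <= l1norm u.
Proof.
rewrite -ler_sqr ?nnegrE ?l2norm_ge0 ?l1norm_ge0 // l2norm_sqr dotE expr2.
rewrite [X in _ <= X * _]/l1norm mulr_suml; apply: ler_sum => i _.
by rewrite -expr2 -real_normK ?num_real // expr2 ler_wpM2l ?entry_le_l1norm.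
Qed.

Lemma l1norm_le_const (R : realType) (n : nat) (u : 'cV[R]_n) (a : R) :
  (forall i, `|u i 0| <= a) -> l1norm u <= n%:R * a.
Proof.
move=> ua; rewrite mulr_natl -[X in _ *+ X](card_ord n) -sumr_const.
exact: ler_sum.
Qed.

Lemma l1norm_le_l2norm (R : realType) (n : nat) (u : 'cV[R]_n) :
  l1norm u <= n%:R * l2norm u.
Proof. by apply: l1norm_le_const => i; exact: entry_le_l2norm. Qed.

Lemma dot_le_l1norm (R : realType) (n : nat) (u v : 'cV[R]_n) (a : R) :
  (forall i, `|u i 0| <= a) -> `|dot u v| <= a * l1norm v.
Proof.
move=> ua; rewrite dotE mulr_sumr; apply: le_trans (ler_norm_sum _ _ _) _.
by apply: ler_sum => i _; rewrite normrM ler_wpM2r.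
Qed.

Lemma mulmx_entry_le (R : realType) (m n : nat) (A : 'M[R]_(m, n)) u (a : R) i :
  (forall j, `|A i j| <= a) -> `|(A *m u) i 0| <= a * l1norm u.
Proof.
move=> Aa; have -> : (A *m u) i 0 = dot (row i A)^T u.
  by rewrite /dot trmxK -row_mul [RHS]mxE.
by apply: dot_le_l1norm => j; rewrite !mxE.
Qed.

(** Makes the set whose supremum is the spectral norm bounded; without this the
    supremum would be a default value. *)
Lemma spectral_norm_bound (R : realType) (m n : nat) (A : 'M[R]_(m, n)) u :
  l2ball R n u -> l2norm (A *m u) <= \sum_i \sum_j `|A i j|.
Proof.
move=> u1; apply: le_trans (l2norm_le_l1norm _) _; apply: ler_sum => i _.
rewrite mxE; apply: le_trans (ler_norm_sum _ _ _) _; apply: ler_sum => j _.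
by rewrite normrM ler_piMr // (le_trans (entry_le_l2norm _ _)).
Qed.

Lemma spectral_norm_le_sum (R : realType) (m n : nat) (A : 'M[R]_(m, n)) :
  spectral_norm A <= \sum_i \sum_j `|A i j|.
Proof.
rewrite /spectral_norm; apply: ge_sup => [|_ [u u1 <-]]; last exact: spectral_norm_bound.
exists (l2norm (A *m 0)), 0 => //; rewrite /l2ball /=.
by rewrite (le_trans (l2norm_le_l1norm _)) // /l1norm big1 // => i _; rewrite mxE normr0.
Qed.

Lemma entry_le_spectral_norm (R : realType) (m n : nat) (A : 'M[R]_(m, n)) i j :
  `|A i j| <= spectral_norm A.
Proof.
have e1 : l2ball R n (delta_mx j 0).
  rewrite /l2ball /= (le_trans (l2norm_le_l1norm _)) // /l1norm (bigD1 j) //= big1.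
    by rewrite mxE !eqxx normr1 addr0.
  by move=> k kj; rewrite mxE (negbTE kj) normr0.
have -> : A i j = (A *m (delta_mx j 0 : 'cV_n)) i 0.
  rewrite mxE (bigD1 j) //= mxE !eqxx mulr1 big1 ?addr0 // => k kj.
  by rewrite mxE (negbTE kj) mulr0.
apply: le_trans (entry_le_l2norm _ _) _; apply: ub_le_sup.
  by exists (\sum_i \sum_j `|A i j|) => _ [u u1 <-]; exact: spectral_norm_bound.
by exists (delta_mx j 0).
Qed.

Lemma spectral_norm_ge0 (R : realType) (m n : nat) (A : 'M[R]_(m, n)) :
  0 <= spectral_norm A.
Proof.
have l20 k : l2norm (0 : 'cV[R]_k) = 0.
  by rewrite /l2norm big1 ?sqrtr0 // => i _; rewrite mxE expr0n.
apply: ub_le_sup.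
  by exists (\sum_i \sum_j `|A i j|) => _ [u u1 <-]; exact: spectral_norm_bound.
by exists 0; rewrite ?mulmx0 // /l2ball /= l20.
Qed.

(** * The distance of parameters *)

Lemma param_dist_ge0 (R : realType) (m n : nat) (p q : param R m n) :
  0 <= param_dist p q.
Proof. exact: sqrtr_ge0. Qed.

Lemma ler_sqrt_abs (R : realType) (a s : R) : a ^+ 2 <= s -> `|a| <= Num.sqrt s.
Proof. by move=> as2; rewrite -sqrtr_sqr ler_wsqrtr. Qed.

Lemma lambda_le_param_dist (R : realType) (m n : nat) (p q : param R m n) :
  `|p.1.1 - q.1.1| <= param_dist p q.
Proof. by apply: ler_sqrt_abs; rewrite -addrA lerDl addr_ge0 ?sqr_ge0. Qed.

Lemma vector_le_param_dist (R : realType) (m n : nat) (p q : param R m n) i :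
  `|p.1.2 i 0 - q.1.2 i 0| <= param_dist p q.
Proof.
have -> : p.1.2 i 0 - q.1.2 i 0 = (p.1.2 - q.1.2) i 0 by rewrite !mxE.
apply: le_trans (entry_le_l2norm _ _) (le_trans (ler_norm _) _).
by apply: ler_sqrt_abs; rewrite addrAC lerDr addr_ge0 ?sqr_ge0.
Qed.

Lemma matrix_le_param_dist (R : realType) (m n : nat) (p q : param R m n) i j :
  `|p.2 i j - q.2 i j| <= param_dist p q.
Proof.
have -> : p.2 i j - q.2 i j = (p.2 - q.2) i j by rewrite !mxE.
apply: le_trans (entry_le_spectral_norm _ _ _) (le_trans (ler_norm _) _).
by apply: ler_sqrt_abs; rewrite lerDr addr_ge0 ?sqr_ge0.
Qed.

(** Entrywise bounds in both directions ([matrix_le_param_dist] and this lemma)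
    allow all estimates below to be made entry by entry. *)
Lemma param_dist_matrix (R : realType) (m n : nat) (u : R^o * 'cV[R]_m)
    (A A' : 'M[R]_(m, n)) :
  param_dist (u, A) (u, A') <= \sum_i \sum_j `|A i j - A' i j|.
Proof.
rewrite /param_dist /= !subrr expr0n /= l2norm_sqr dot0r !add0r sqrtr_sqr.
rewrite ger0_norm ?spectral_norm_ge0 //; apply: le_trans (spectral_norm_le_sum _) _.
by apply: ler_sum => i _; apply: ler_sum => j _; rewrite !mxE.
Qed.

(** * Entrywise convergence of matrices *)

(** Equivalent to convergence in the matrix topology, but directly compatible
    with formulas for the entries of sums and products. *)
Definition entrywise_cvg (R : realType) (T : Type) (F : set_system T)
    (m n : nat) (M : T -> 'M[R]_(m, n)) (L : 'M[R]_(m, n)) : Prop :=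
  forall i j, M t i j @[t --> F] --> L i j.

Section EntrywiseConvergence.
Variables (R : realType) (T : Type) (F : set_system T).
Hypothesis FF : Filter F.

Lemma cvg_bigsum (k : nat) (f : 'I_k -> T -> R) (a : 'I_k -> R) :
  (forall i, f i t @[t --> F] --> a i) ->
  \sum_(i < k) f i t @[t --> F] --> \sum_(i < k) a i.
Proof.
move=> fa; apply: cvg_big => [|i _]; last exact: fa.
exact: add_continuous.
Qed.

Lemma entrywise_cvg_cst (m n : nat) (L : 'M[R]_(m, n)) :
  entrywise_cvg F (fun=> L) L.
Proof. by move=> i j; exact: cvg_cst. Qed.

Lemma entrywise_cvgT (m n : nat) (M : T -> 'M[R]_(m, n)) L :
  entrywise_cvg F M L -> entrywise_cvg F (fun t => (M t)^T) L^T.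
Proof.
move=> ML i j; rewrite mxE (_ : (fun t => _) = fun t => M t j i) //.
by apply/funext => t; rewrite mxE.
Qed.

Lemma entrywise_cvgD (m n : nat) (M N : T -> 'M[R]_(m, n)) L K :
  entrywise_cvg F M L -> entrywise_cvg F N K ->
  entrywise_cvg F (fun t => M t + N t) (L + K).
Proof.
move=> ML NK i j; rewrite mxE (_ : (fun t => _) = fun t => M t i j + N t i j).
  by apply: cvgD; [exact: ML | exact: NK].
by apply/funext => t; rewrite mxE.
Qed.

Lemma entrywise_cvgZ (m n : nat) (f : T -> R) (a : R) (M : T -> 'M[R]_(m, n)) L :
  f t @[t --> F] --> a -> entrywise_cvg F M L ->
  entrywise_cvg F (fun t => f t *: M t) (a *: L).
Proof.
move=> fa ML i j; rewrite mxE (_ : (fun t => _) = fun t => f t * M t i j).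
  by apply: cvgM; [exact: fa | exact: ML].
by apply/funext => t; rewrite mxE.
Qed.

Lemma entrywise_cvgB (m n : nat) (M N : T -> 'M[R]_(m, n)) L K :
  entrywise_cvg F M L -> entrywise_cvg F N K ->
  entrywise_cvg F (fun t => M t - N t) (L - K).
Proof.
move=> ML NK; apply: entrywise_cvgD => // i j.
rewrite mxE (_ : (fun t => _) = fun t => - N t i j).
  by apply: cvgN; exact: NK.
by apply/funext => t; rewrite mxE.
Qed.

Lemma entrywise_cvg_mulmx (m n k : nat) (M : T -> 'M[R]_(m, n))
    (N : T -> 'M[R]_(n, k)) L K :
  entrywise_cvg F M L -> entrywise_cvg F N K ->
  entrywise_cvg F (fun t => M t *m N t) (L *m K).
Proof.
move=> ML NK i j; rewrite mxE.
rewrite (_ : (fun t => _) = fun t => \sum_j0 M t i j0 * N t j0 j).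
  by apply: cvg_bigsum => k0; apply: cvgM; [exact: ML | exact: NK].
by apply/funext => t; rewrite mxE.
Qed.

Lemma cvg_dot (n : nat) (u v : T -> 'cV[R]_n) a b :
  entrywise_cvg F u a -> entrywise_cvg F v b ->
  dot (u t) (v t) @[t --> F] --> dot a b.
Proof.
by move=> ua vb; apply: entrywise_cvg_mulmx => //; exact: entrywise_cvgT.
Qed.

Lemma cvg_l1norm (n : nat) (u : T -> 'cV[R]_n) a :
  entrywise_cvg F u a -> l1norm (u t) @[t --> F] --> l1norm a.
Proof. by move=> ua; apply: cvg_bigsum => i; apply: cvg_norm; exact: ua. Qed.

Lemma cvg_l2norm (n : nat) (u : T -> 'cV[R]_n) a :
  entrywise_cvg F u a -> l2norm (u t) @[t --> F] --> l2norm a.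
Proof.
move=> ua; have l2E v : l2norm v = Num.sqrt (dot v v) :> R.
  by rewrite -l2norm_sqr sqrtr_sqr ger0_norm // l2norm_ge0.
rewrite l2E (_ : (fun t => _) = Num.sqrt \o (fun t => dot (u t) (u t))); last first.
  by apply/funext => t /=; rewrite l2E.
by apply: continuous_cvg; [exact: sqrt_continuous | exact: cvg_dot].
Qed.

End EntrywiseConvergence.

(** * Optimality conditions and existence of Lasso solutions *)

(** [lambda] times the penalized objective, with [c] either the data vector or
    its projection onto the range: the two differ by a constant. *)
Definition lasso_objective (R : realType) (m n : nat) (l : R) (c : 'cV[R]_m)
    (A : 'M[R]_(m, n)) (x : 'cV[R]_n) : R :=
  2^-1 * dot (c - A *m x) (c - A *m x) + l * l1norm x.

Definition correlation (R : realType) (m n : nat) (b : 'cV[R]_m)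
    (A : 'M[R]_(m, n)) (x : 'cV[R]_n) : 'cV[R]_n :=
  A^T *m (b - A *m x).

(** The inclusion of the correlations in [l] times the subdifferential of the
    l1-norm at [x]. The second clause says that [correlation b A x i 0] is [l]
    times the sign of [x i 0] when that coordinate is not zero. *)
Definition kkt (R : realType) (m n : nat) (l : R) (b : 'cV[R]_m)
    (A : 'M[R]_(m, n)) (x : 'cV[R]_n) : Prop :=
  forall i, `|correlation b A x i 0| <= l /\
    correlation b A x i 0 * x i 0 = l * `|x i 0|.

Lemma le_of_le_add_small (R : realType) (u v c : R) :
  (forall e, 0 < e < 1 -> u <= v + e * c) -> u <= v.
Proof.
move=> H; rewrite leNgt; apply/negP => vu.
set e := (u - v) / (2 * (`|c| + (u - v) + 1)).
have c0 : 0 <= `|c| by [].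
have dpos : 0 < 2 * (`|c| + (u - v) + 1) by lra.
have edef : e * (2 * (`|c| + (u - v) + 1)) = u - v.
  by rewrite /e mulfVK // gt_eqF.
have e0 : 0 < e by rewrite /e divr_gt0 // subr_gt0.
have e1 : e < 1 by rewrite /e ltr_pdivrMr // mul1r; lra.
have := H e; rewrite e0 e1 => /(_ isT).
have : e * c <= e * `|c| by rewrite ler_wpM2l ?ler_norm // ltW.
have : 0 <= e * (u - v + 1) by rewrite mulr_ge0; lra.
nra.
Qed.

(** One coordinate of Fermat's rule. Small [t] of either sign bound [g], and
    small multiples [t] of [- x] give the equality. *)
Lemma scalar_lasso_optimality (R : realType) (g x l a : R) :
  0 <= l -> (forall t, t * g <= t ^+ 2 * a + l * (`|x + t| - `|x|)) ->
  `|g| <= l /\ g * x = l * `|x|.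
Proof.
move=> l0 H.
have gl : `|g| <= l.
  apply: (@le_of_le_add_small _ _ _ a) => e /andP[e0 _].
  have Hs (s : R) : `|s| = 1 -> s * g <= l + e * a.
    move=> s1; rewrite -(ler_pM2l e0) mulrDr mulrA.
    have s2 : s ^+ 2 = 1 by rewrite -real_normK ?num_real // s1 expr1n.
    apply: le_trans (H (e * s)) _; rewrite exprMn s2 mulr1 addrC expr2 mulrA lerD2r.
    rewrite [e * l]mulrC; apply: ler_wpM2l => //.
    have := ler_normD x (e * s); rewrite normrM s1 mulr1 (gtr0_norm e0).
    by rewrite lerBlDl.
  rewrite ler_norml; apply/andP; split.
    by have := Hs (-1); rewrite normrN1 mulN1r => /(_ erefl); lra.
  by have := Hs 1; rewrite normr1 mul1r => /(_ erefl).
split=> //; apply/eqP; rewrite eq_le; apply/andP; split.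
  by apply: le_trans (ler_norm _) _; rewrite normrM ler_wpM2r.
apply: (@le_of_le_add_small _ _ _ (x ^+ 2 * a)) => e /andP[e0 e1].
have := H (- (e * x)).
have -> : x - e * x = (1 - e) * x by ring.
rewrite normrM ger0_norm; last by rewrite subr_ge0 ltW.
move=> H'; rewrite -(ler_pM2l e0).
move: H'; rewrite sqrrN; set q := `|x|; nra.
Qed.

Lemma lasso_objectiveB (R : realType) (m n : nat) (l : R) (c : 'cV[R]_m)
    (A : 'M[R]_(m, n)) (x z : 'cV[R]_n) :
  lasso_objective l c A (x + z) - lasso_objective l c A x =
  2^-1 * dot (A *m z) (A *m z) - dot (correlation c A x) z
  + l * (l1norm (x + z) - l1norm x).
Proof.
rewrite /lasso_objective /correlation dot_trmx mulmxDr.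
have -> : c - (A *m x + A *m z) = (c - A *m x) - A *m z.
  by rewrite opprD addrA.
move: (c - A *m x) (A *m z) => r y.
by rewrite !(dotBr, dotBl) (dotC y r); field.
Qed.

Lemma dot_le_l1norm_kkt (R : realType) (m n : nat) (l : R) (b : 'cV[R]_m)
    (A : 'M[R]_(m, n)) (x y : 'cV[R]_n) :
  kkt l b A x -> dot (correlation b A x) y <= l * l1norm y.
Proof.
move=> kx; apply: le_trans (ler_norm _) _; apply: dot_le_l1norm => i.
by case: (kx i).
Qed.

Lemma dot_kkt (R : realType) (m n : nat) (l : R) (b : 'cV[R]_m)
    (A : 'M[R]_(m, n)) (x : 'cV[R]_n) :
  kkt l b A x -> dot (correlation b A x) x = l * l1norm x.
Proof.
by move=> kx; rewrite dotE mulr_sumr; apply: eq_bigr => i _; case: (kx i).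
Qed.

(** Necessity comes from moving one coordinate at a time. Sufficiency is
    convexity: the increment of the quadratic part is at least its linear part,
    which the bound on the correlations makes at least minus the increment of
    the penalty. *)
Lemma lasso_objective_minP (R : realType) (m n : nat) (l : R) (c : 'cV[R]_m)
    (A : 'M[R]_(m, n)) (x : 'cV[R]_n) : 0 <= l ->
  (forall y, lasso_objective l c A x <= lasso_objective l c A y) <->
  kkt l c A x.
Proof.
move=> l0; split=> [xmin i|kx y]; last first.
  rewrite -subr_ge0 -[y in lasso_objective _ _ _ y](subrKC x) lasso_objectiveB.
  rewrite subrKC dotBr (dot_kkt kx).
  have := dot_le_l1norm_kkt y kx; have := dot_ge0 (A *m (y - x)); lra.
set d : 'cV[R]_n := delta_mx i 0.
apply: (@scalar_lasso_optimality _ _ _ _ (2^-1 * dot (A *m d) (A *m d))) => // t.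
have := xmin (x + t *: d); rewrite -subr_ge0 lasso_objectiveB.
rewrite -scalemxAr !dotZr dotZl.
have -> : dot (correlation c A x) d = correlation c A x i 0.
  rewrite dotE (bigD1 i) //= [in X in _ * X + _]mxE !eqxx mulr1 big1 ?addr0 // => k ki.
  by rewrite [in X in _ * X]mxE (negbTE ki) mulr0.
have -> : l1norm (x + t *: d) - l1norm x = `|x i 0 + t| - `|x i 0|.
  rewrite /l1norm (bigD1 i) //= [X in _ - X](bigD1 i) //= !mxE !eqxx mulr1.
  rewrite [X in _ + X - _](eq_bigr (fun k => `|x k 0|)).
    by rewrite opprD addrACA subrr addr0.
  by move=> k ki; rewrite !mxE (negbTE ki) mulr0 addr0.
lra.
Qed.

Lemma mulmx_trmx_eq0 (R : realType) (m n : nat) (A : 'M[R]_(m, n)) :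
  A^T *m A = 0 -> A = 0.
Proof.
move=> A0; apply/matrixP => i j.
have /dot_eq0/colP/(_ i) : dot (col j A) (col j A) = 0.
  have := congr1 (fun M : 'M[R]_n => M j j) A0; rewrite !mxE => <-.
  by rewrite dotE; apply: eq_bigr => k _; rewrite !mxE.
by rewrite !mxE.
Qed.

(** The rows of [A^T A] span those of [A], as both have the same kernel. *)
Lemma normal_equations (R : realType) (m n : nat) (A : 'M[R]_(m, n))
    (b : 'cV[R]_m) :
  exists x, A^T *m (b - A *m x) = 0.
Proof.
have /submxP[D bD] : (b^T *m A <= A^T *m A)%MS.
  rewrite submxE -mulmxA; have -> : A *m cokermx (A^T *m A) = 0.
    apply: mulmx_trmx_eq0; rewrite trmx_mul -!mulmxA (mulmxA A^T).
    by rewrite mulmx_coker mulmx0.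
  by rewrite mulmx0.
exists D^T; apply/eqP; rewrite mulmxBr subr_eq0; apply/eqP.
by apply: trmx_inj; rewrite !trmx_mul !trmxK -mulmxA bD.
Qed.

(** A solution [x0] of the normal equations gives a nearest point [A *m x0], and
    by Pythagoras every nearest point equals it. *)
Lemma euclidean_proj_orthogonal (R : realType) (m n : nat) (A : 'M[R]_(m, n))
    (b : 'cV[R]_m) : A^T *m (b - euclidean_proj (rge A) b) = 0.
Proof.
have [x0 x0P] := normal_equations A b.
have pyth x : dot (A *m x - b) (A *m x - b) =
    dot (A *m (x - x0)) (A *m (x - x0)) + dot (A *m x0 - b) (A *m x0 - b).
  have : dot (A *m (x - x0)) (A *m x0 - b) = 0.
    by rewrite dotC -dot_trmx -opprB mulmxN x0P dotC dotNr dot0r oppr0.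
  rewrite mulmxBr !(dotBl, dotBr) (dotC b) (dotC (A *m x0) (A *m x)) (dotC b (A *m x0)).
  lra.
have sqle (u v : 'cV[R]_m) : (l2norm u <= l2norm v) = (dot u u <= dot v v).
  by rewrite -!l2norm_sqr ler_sqr ?nnegrE ?l2norm_ge0.
rewrite /euclidean_proj; set C := minimizers _ _.
have [|[x _ <-] xmin] := @xgetPex _ 0 C.
  exists (A *m x0); split=> [|_ [x _ <-]]; first by exists x0.
  by rewrite sqle (pyth x) lerDr dot_ge0.
have := xmin _ (ex_intro2 _ _ x0 I erefl); rewrite sqle (pyth x).
rewrite gerDr => le0; have /dot_eq0 /eqP : dot (A *m (x - x0)) (A *m (x - x0)) = 0.
  by apply/eqP; rewrite eq_le le0 dot_ge0.
by rewrite mulmxBr subr_eq0 => /eqP ->.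
Qed.

(** The correlations are the same for [b] and for its projection, as their
    difference is orthogonal to the columns of [A]. *)
Lemma lasso_solutionsP (R : realType) (m n : nat) (l : R) (b : 'cV[R]_m)
    (A : 'M[R]_(m, n)) (x : 'cV[R]_n) : 0 < l ->
  lasso_solutions (l, b, A) x <-> kkt l b A x.
Proof.
move=> l0; rewrite /lasso_solutions l0; set p := euclidean_proj _ _.
have corrE : correlation p A x = correlation b A x.
  have /eqP := euclidean_proj_orthogonal A b; rewrite mulmxBr subr_eq0 => /eqP Ap.
  by rewrite /correlation !mulmxBr Ap.
rewrite (_ : kkt l b A x <-> kkt l p A x); last by rewrite /kkt corrE.
have objE y : (2 * l)^-1 * l2norm (A *m y - p) ^+ 2 + l1norm y =
    l^-1 * lasso_objective l p A y.
  rewrite /lasso_objective l2norm_sqr -opprB dotNr dotC dotNr opprK.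
  by field; rewrite gt_eqF.
rewrite -(lasso_objective_minP _ _ _ (ltW l0)); split=> [[_ xmin] y|xmin].
  by have := xmin y I; rewrite !objE ler_pM2l ?invr_gt0.
by split=> // y _; rewrite !objE ler_pM2l ?invr_gt0.
Qed.

Lemma cvg_lasso_objective (R : realType) (T : Type) (F : set_system T)
    (m n : nat) (l : R) (c : 'cV[R]_m) (A : 'M[R]_(m, n)) (x : T -> 'cV[R]_n) a :
  Filter F -> entrywise_cvg F x a ->
  lasso_objective l c A (x t) @[t --> F] --> lasso_objective l c A a.
Proof.
move=> FF xa.
have cvr : entrywise_cvg F (fun t => c - A *m x t) (c - A *m a).
  apply: entrywise_cvgB; first exact: entrywise_cvg_cst.
  by apply: entrywise_cvg_mulmx => //; exact: entrywise_cvg_cst.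
by apply: cvgD; apply: cvgM; try exact: cvg_cst; [exact: cvg_dot | exact: cvg_l1norm].
Qed.

Lemma lasso_objective_continuous (R : realType) (m n : nat) (l : R)
    (c : 'cV[R]_m) (A : 'M[R]_(m, n)) :
  continuous (fun v : 'rV[R]_n => lasso_objective l c A v^T).
Proof.
move=> v; apply: (@cvg_lasso_objective _ _ (nbhs v)).
by apply: entrywise_cvgT => i j; exact: coord_continuous.
Qed.

(** The objective is continuous, and outside a large box the penalty alone
    exceeds the value at 0. *)
Lemma kkt_exists (R : realType) (m n : nat) (l : R) (b : 'cV[R]_m)
    (A : 'M[R]_(m, n)) : 0 < l -> exists x, kkt l b A x.
Proof.
move=> l0; set f := lasso_objective l b A.
set K := l^-1 * f 0.
have f0 : 0 <= f 0.
  by rewrite addr_ge0 ?mulr_ge0 ?dot_ge0 ?invr_ge0 ?l1norm_ge0 // ltW.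
pose box := [set v : 'rV[R]_n | forall i, `[- K, K]%classic (v ord0 i)].
have K0 : 0 <= K by rewrite mulr_ge0 // invr_ge0 ltW.
have box0 : box 0 by move=> i /=; rewrite mxE in_itv /= oppr_le0 K0.
have [||v _ vmin] := @compact_EVT_min _ R (fun v => f v^T) box (ex_intro _ _ box0).
- by apply: (@rV_compact R n (fun=> `[- K, K]%classic)) => i; exact: segment_compact.
- exact/continuous_subspaceT/lasso_objective_continuous.
exists v^T; apply/lasso_objective_minP => [|y]; first exact: ltW.
have [ybox|] := pselect (box y^T).
  by have := vmin y^T; rewrite inE trmxK => /(_ ybox).
rewrite /box /= => /existsNP[i]; rewrite in_itv /= mxE -ler_norml => /negP.
rewrite -ltNge => yi; have := vmin 0; rewrite inE trmx0 => /(_ box0) /le_trans; apply.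
have : f 0 < l * l1norm y.
  rewrite -ltr_pdivrMl //; exact: lt_le_trans yi (entry_le_l1norm _ _).
have : f y = 2^-1 * dot (b - A *m y) (b - A *m y) + l * l1norm y by [].
rewrite -/(f y); have := dot_ge0 (b - A *m y); lra.
Qed.

(** * Stability estimates *)

Definition close (R : realType) (m n : nat) (e : R) (p q : param R m n) : Prop :=
  [/\ `|p.1.1 - q.1.1| <= e, forall i, `|p.1.2 i 0 - q.1.2 i 0| <= e
    & forall i j, `|p.2 i j - q.2 i j| <= e].

Definition lasso_kkt (R : realType) (m n : nat) (p : param R m n) : 'cV[R]_n -> Prop :=
  kkt (p.1.1 : R) p.1.2 p.2.

Lemma close_param_dist (R : realType) (m n : nat) (p q : param R m n) :
  close (param_dist p q) p q.
Proof.
split=> [|i|i j]; first exact: lambda_le_param_dist.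
- exact: vector_le_param_dist.
- exact: matrix_le_param_dist.
Qed.

Lemma closeW (R : realType) (m n : nat) (d e : R) (p q : param R m n) :
  d <= e -> close d p q -> close e p q.
Proof.
move=> de [pl pb pA]; split=> [|i|i j]; first exact: le_trans de.
- exact: le_trans (pb i) de.
- exact: le_trans (pA i j) de.
Qed.

Lemma lasso_kkt_inactive (R : realType) (m n : nat) (l : R) (b : 'cV[R]_m)
    (A : 'M[R]_(m, n)) x i :
  kkt l b A x -> `|correlation b A x i 0| < l -> x i 0 = 0.
Proof.
move=> /(_ i)[_ gx] gl; apply/eqP/negPn/negP => xi0; move: gl.
have := congr1 Num.norm gx; rewrite !normrM normr_id.
have x0 : 0 < `|x i 0| by rewrite normr_gt0.
move/(mulIf (lt0r_neq0 x0)) => ->.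
by rewrite ltNge ler_norm.
Qed.

Lemma l1norm_mulmx_le (R : realType) (m n : nat) (A : 'M[R]_(m, n)) u (a : R) :
  (forall i j, `|A i j| <= a) -> l1norm (A *m u) <= m%:R * (a * l1norm u).
Proof. by move=> Aa; apply: l1norm_le_const => i; apply: mulmx_entry_le. Qed.

(** Monotonicity of the subdifferential of the l1-norm. The right-hand side
    accounts for the two subdifferentials being scaled differently. *)
Lemma kkt_monotone (R : realType) (m n : nat) (l l' : R) (b b' : 'cV[R]_m)
    (A A' : 'M[R]_(m, n)) (x x' : 'cV[R]_n) :
  kkt l b A x -> kkt l' b' A' x' ->
  - dot (correlation b A x - correlation b' A' x') (x - x')
    <= `|l - l'| * l1norm (x - x').
Proof.
move=> kx kx'; rewrite dotBl !dotBr (dot_kkt kx) (dot_kkt kx').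
have := dot_le_l1norm_kkt x' kx; have := dot_le_l1norm_kkt x kx'.
have zx : `|l1norm x - l1norm x'| <= l1norm (x - x').
  have h1 := l1normD (x - x') x'; have h2 := l1normD (x' - x) x.
  rewrite !subrK in h1 h2; have h3 := l1normN (x' - x); rewrite opprB in h3.
  by rewrite ler_norml; apply/andP; split; lra.
have : (l' - l) * (l1norm x - l1norm x') <= `|l - l'| * l1norm (x - x').
  apply: le_trans (ler_norm _) _; rewrite normrM distrC.
  by rewrite ler_wpM2l.
lra.
Qed.

Lemma residual_gap (R : realType) (m n : nat) (b b' : 'cV[R]_m)
    (A A' : 'M[R]_(m, n)) (x x' : 'cV[R]_n) :
  (b - A *m x) - (b' - A' *m x') =
  (b - b' - (A - A') *m x') - A *m (x - x').
Proof.
rewrite mulmxBl mulmxBr; apply/colP => i; rewrite !mxE; ring.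
Qed.

Section Gap.
Variables (R : realType) (m n : nat) (p p' : param R m n) (x x' : 'cV[R]_n).
Variables (D B : R).
Hypotheses (D0 : 0 <= D) (B0 : 0 <= B) (pp' : close D p p').
Hypotheses (pA : forall i j, `|p.2 i j| <= B) (pb' : forall i, `|p'.1.2 i 0| <= B)
  (pA' : forall i j, `|p'.2 i j| <= B) (x'B : l1norm x' <= B).

Local Notation l := (p.1.1 : R).
Local Notation b := p.1.2.
Local Notation A := p.2.
Local Notation l' := (p'.1.1 : R).
Local Notation b' := p'.1.2.
Local Notation A' := p'.2.
Local Notation z := (x - x').
Local Notation r' := (b' - A' *m x').
Local Notation e := (b - b' - (A - A') *m x').

Lemma shift_le i : `|e i 0| <= D * (1 + B).
Proof.
case: pp' => _ hb hA; rewrite mulrDr mulr1.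
rewrite [X in `|X|]mxE [X in `|_ + X|]mxE; apply: le_trans (ler_normB _ _) _.
apply: lerD; first by rewrite !mxE.
have : `|((A - A') *m x') i 0| <= D * l1norm x'.
  by apply: mulmx_entry_le => j; rewrite !mxE.
by move=> /le_trans; apply; rewrite ler_wpM2l.
Qed.

Lemma residual_le i : `|r' i 0| <= B + B * B.
Proof.
rewrite [X in `|X|]mxE [X in `|_ + X|]mxE; apply: le_trans (ler_normB _ _) _.
apply: lerD => //; have : `|(A' *m x') i 0| <= B * l1norm x'.
  by apply: mulmx_entry_le => j.
by move=> /le_trans; apply; rewrite ler_wpM2l.
Qed.

(** The basic estimate: the difference of the optimality conditions, tested
    against [x - x'], and monotonicity. The factor [l1norm (x - x')] on the right
    turns it into a Lipschitz bound as soon as [A] is injective on the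
    differences of solutions. *)
Lemma fit_gap : lasso_kkt p x -> lasso_kkt p' x' ->
  dot (A *m z) (A *m z) <= (1 + 2 * m%:R * B * (1 + B)) * D * l1norm z.
Proof.
move=> kx kx'; case: (pp') => hl hb hA.
have z0 : 0 <= l1norm z by exact: l1norm_ge0.
have -> : dot (A *m z) (A *m z) = dot e (A *m z) + dot r' ((A - A') *m z)
    - dot (correlation b A x - correlation b' A' x') z.
  rewrite dotBl /correlation !dot_trmx.
  have -> : b - A *m x = r' + (e - A *m z).
    by rewrite -(residual_gap b b' A A' x x') [RHS]addrC subrK.
  move: e r' => e0 r0; rewrite mulmxBl; move: (A *m z) (A' *m z) => y y'.
  by rewrite !(dotDl, dotNl, dotDr, dotNr); ring.
have t1 : dot e (A *m z) <= D * (1 + B) * (m%:R * (B * l1norm z)).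
  apply: le_trans (ler_norm _) _; apply: le_trans (dot_le_l1norm _ shift_le) _.
  rewrite ler_wpM2l ?mulr_ge0 ?addr_ge0 //.
  exact: l1norm_mulmx_le.
have t2 : dot r' ((A - A') *m z) <= (B + B * B) * (m%:R * (D * l1norm z)).
  apply: le_trans (ler_norm _) _; apply: le_trans (dot_le_l1norm _ residual_le) _.
  rewrite ler_wpM2l ?addr_ge0 ?mulr_ge0 //.
  by apply: l1norm_mulmx_le => i j; rewrite !mxE.
have t3 := kkt_monotone kx kx'.
have t4 : `|l - l'| * l1norm z <= D * l1norm z by rewrite ler_wpM2r.
apply: le_trans (lerD (lerD t1 t2) (le_trans t3 t4)) _.
rewrite le_eqVlt; apply/orP; left; apply/eqP; ring.
Qed.
(** Correlations inherit the closeness of the fits, with the gap [a] between the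
    fits in general of larger order than [D]. *)
Lemma correlation_gap (a : R) i :
  (forall k, `|(A *m z) k 0| <= a) ->
  `|correlation b A x i 0 - correlation b' A' x' i 0| <=
    m%:R * (B * (D * (1 + B) + a) + D * (B + B * B)).
Proof.
move=> fa; case: (pp') => hl hb hA.
have eB : l1norm (e - A *m z) <= m%:R * (D * (1 + B) + a).
  apply: l1norm_le_const => k; rewrite [X in `|X|]mxE [X in `|_ + X|]mxE.
  by apply: le_trans (ler_normB _ _) _; rewrite lerD ?fa // shift_le.
have rB : l1norm r' <= m%:R * (B + B * B).
  by apply: l1norm_le_const => k; exact: residual_le.
have -> : correlation b A x i 0 - correlation b' A' x' i 0 =
    (A^T *m (e - A *m z)) i 0 + ((A - A')^T *m r') i 0.
  have rE : b - A *m x = r' + (e - A *m z).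
    by rewrite -(residual_gap b b' A A' x x') [RHS]addrC subrK.
  rewrite /correlation rE; move: e r' => e0 r0.
  rewrite mulmxDr [(_ - _)^T]linearB /= mulmxBl.
  move: (A^T *m r0) (A^T *m (e0 - A *m z)) (A'^T *m r0) => a1 a2 a3.
  by rewrite !mxE; ring.
have t1 : `|(A^T *m (e - A *m z)) i 0| <= B * l1norm (e - A *m z).
  by apply: mulmx_entry_le => j; rewrite mxE.
have t2 : `|((A - A')^T *m r') i 0| <= D * l1norm r'.
  by apply: mulmx_entry_le => j; rewrite !mxE.
apply: le_trans (ler_normD _ _) _; rewrite mulrDr; apply: lerD.
  by apply: le_trans t1 _; rewrite mulrCA ler_wpM2l.
by apply: le_trans t2 _; rewrite mulrCA ler_wpM2l.
Qed.

End Gap.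

(** Testing the optimality condition against [x] itself. *)
Lemma kkt_l1norm_le (R : realType) (m n : nat) (l : R) (b : 'cV[R]_m)
    (A : 'M[R]_(m, n)) x (B : R) : 0 <= B -> (forall i, `|b i 0| <= B) ->
  kkt l b A x -> l * l1norm x <= m%:R * B ^+ 2.
Proof.
move=> B0 bB kx; rewrite -(dot_kkt kx) /correlation dot_trmx.
have := dot_ge0 (b - A *m x); have := dot_ge0 (A *m x); have := dot_ge0 b.
have : dot b b <= m%:R * B ^+ 2.
  apply: le_trans (ler_norm _) _; apply: le_trans (dot_le_l1norm _ bB) _.
  by rewrite expr2 mulrCA ler_wpM2l // l1norm_le_const.
rewrite !(dotBl, dotBr) (dotC (A *m x) b); lra.
Qed.

(** * Local Lipschitz continuity *)

(** Linear independence of the columns selected by [J]. *)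
Definition injective_on (R : realType) (m n : nat) (A : 'M[R]_(m, n))
    (J : pred 'I_n) : Prop :=
  forall w : 'cV[R]_n, (forall i, ~~ J i -> w i 0 = 0) -> A *m w = 0 -> w = 0.

(** With [P] the diagonal projection onto the coordinates in [J], the hypothesis
    says that [P] vanishes on the kernel of [A *m P], hence factors through it. *)
Lemma injective_on_left_inverse (R : realType) (m n : nat) (A : 'M[R]_(m, n)) J :
  injective_on A J -> exists L : 'M[R]_(n, m),
    forall w : 'cV[R]_n, (forall i, ~~ J i -> w i 0 = 0) -> L *m (A *m w) = w.
Proof.
move=> Ainj; pose P : 'M[R]_n := diag_mx (\row_j (J j)%:R).
have PE k (M : 'M[R]_(n, k)) i j : (P *m M) i j = (J i)%:R * M i j.
  by rewrite /P mul_diag_mx !mxE.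
have /submxP[L PL] : (P <= A *m P)%MS.
  rewrite submxE; apply/eqP/matrixP => i k.
  have: A *m P *m cokermx (A *m P) = 0 by exact: mulmx_coker.
  move: (cokermx _) => K PK; have /Ainj/colP/(_ i) : A *m col k (P *m K) = 0.
    by rewrite colE !mulmxA PK mul0mx.
  by rewrite !mxE; apply => j Jj; rewrite mxE PE (negbTE Jj) mul0r.
exists L => w wJ; have wP : P *m w = w.
  apply/colP => i; rewrite PE; case: (boolP (J i)) => [_|/wJ ->]; first by rewrite mul1r.
  by rewrite mulr0.
by rewrite -{1}wP (mulmxA A) mulmxA -PL.
Qed.

(** The perturbation [A - A0] is absorbed in the left-hand side as soon as it
    is small compared with the left inverse [L]. *)
Lemma left_inverse_stable (R : realType) (m n : nat) (A A0 : 'M[R]_(m, n))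
    (L : 'M[R]_(n, m)) (c d : R) (z : 'cV[R]_n) :
  0 <= c -> (forall i j, `|L i j| <= c) -> (forall i j, `|A i j - A0 i j| <= d) ->
  n%:R * c * m%:R * d <= 2^-1 -> L *m (A0 *m z) = z ->
  l1norm z <= 2 * n%:R * c * l1norm (A *m z).
Proof.
move=> c0 Lc Ad small Lz.
have zE : l1norm z <= l1norm (L *m (A *m z)) + l1norm (L *m ((A - A0) *m z)).
  apply: le_trans (_ : l1norm (L *m (A *m z) - L *m ((A - A0) *m z)) <= _).
    by rewrite -mulmxBr mulmxBl opprB addrC subrK Lz.
  by apply: le_trans (l1normD _ _) _; rewrite l1normN.
have h1 := l1norm_mulmx_le (A *m z) Lc.
have h2 := l1norm_mulmx_le ((A - A0) *m z) Lc.
have h3 : l1norm ((A - A0) *m z) <= m%:R * (d * l1norm z).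
  by apply: l1norm_mulmx_le => i j; rewrite !mxE.
have h4 : n%:R * (c * l1norm ((A - A0) *m z)) <= 2^-1 * l1norm z.
  apply: le_trans (_ : n%:R * (c * (m%:R * (d * l1norm z))) <= _).
    by rewrite !ler_wpM2l.
  by rewrite !mulrA ler_wpM2r ?l1norm_ge0.
lra.
Qed.

Lemma finite_positive_lower_bound (R : realType) (I : finType) (P : pred I)
    (f : I -> R) :
  (forall i, P i -> 0 < f i) -> exists2 e, 0 < e & forall i, P i -> e <= f i.
Proof.
move=> f0; exists (\big[Order.min/1]_(i | P i) f i) => [|i Pi].
  by elim/big_ind: _ => // x y x0 y0; rewrite lt_min x0 y0.
exact: bigmin_le_cond.
Qed.

Definition solution_bound (R : realType) (m n : nat) (B : R) (p : param R m n) : Prop :=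
  [/\ forall i, `|p.1.2 i 0| <= B, forall i j, `|p.2 i j| <= B
    & forall x, lasso_kkt p x -> l1norm x <= B].

Lemma solutions_locally_bounded (R : realType) (m n : nat) (p0 : param R m n) :
  0 < (p0.1.1 : R) ->
  exists B d : R, [/\ 0 < B, 0 < d & forall p, close d p p0 -> solution_bound B p].
Proof.
case: p0 => [[l0 b0] A0] /= l00.
pose B1 := 1 + \sum_i `|b0 i 0| + \sum_i \sum_j `|A0 i j|.
have s1 i : `|b0 i 0| <= \sum_i `|b0 i 0| by exact: entry_le_l1norm.
have s2 i j : `|A0 i j| <= \sum_i \sum_j `|A0 i j|.
  rewrite (bigD1 i) //= (bigD1 j) //= -addrA lerDl addr_ge0 ?sumr_ge0 // => k _.
  by rewrite sumr_ge0.
have s10 : 0 <= \sum_i `|b0 i 0| by rewrite sumr_ge0.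
have s20 : 0 <= \sum_i \sum_j `|A0 i j|.
  by apply: sumr_ge0 => i _; rewrite sumr_ge0.
have B10 : 0 < B1 by rewrite /B1; lra.
pose B := B1 + 2 * (m%:R * B1 ^+ 2) / l0.
have B1B : B1 <= B by rewrite /B lerDl divr_ge0 ?mulr_ge0 ?sqr_ge0 // ltW.
exists B, (Num.min 1 (l0 / 2)); split.
- exact: lt_le_trans B1B.
- by rewrite lt_min ltr01 divr_gt0.
case=> [[l b] A] /= [/=]; rewrite le_min => /andP[_ hl] hb hA.
have hb1 i : `|b i 0| <= B1.
  have := hb i; rewrite le_min => /andP[h _]; have := s1 i.
  have := ler_normD (b i 0 - b0 i 0) (b0 i 0); rewrite subrK /B1; lra.
have hA1 i j : `|A i j| <= B1.
  have := hA i j; rewrite le_min => /andP[h _]; have := s2 i j.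
  have := ler_normD (A i j - A0 i j) (A0 i j); rewrite subrK /B1; lra.
split=> [i|i j|x kx] /=; [exact: le_trans B1B | exact: le_trans B1B | ].
have := kkt_l1norm_le (ltW B10) hb1 kx; move: hl; rewrite ler_norml => /andP[hl _] kx1.
apply: le_trans (_ : 2 * (m%:R * B1 ^+ 2) / l0 <= _); last by rewrite lerDr ltW.
rewrite ler_pdivlMr //; have := l1norm_ge0 x; have := ler_wpM2r (l1norm_ge0 x) hl.
rewrite /= in kx1 *; nra.
Qed.

(** The columns of the condition: those whose correlation with the residual has
    the largest modulus allowed. *)
Definition active (R : realType) (m n : nat) (p : param R m n) (x : 'cV[R]_n) :
    pred 'I_n :=
  fun i => `|correlation p.1.2 p.2 x i 0| == p.1.1.

(** The fit [A x], hence the correlations, depend continuously on the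
    parameter, so correlations of modulus less than [lambda] remain so. *)
Lemma support_stable (R : realType) (m n : nat) (p0 : param R m n) x0 :
  0 < (p0.1.1 : R) -> lasso_kkt p0 x0 ->
  exists2 d : R, 0 < d & forall p x i, close d p p0 -> lasso_kkt p x ->
    ~~ active p0 x0 i -> x i 0 = 0.
Proof.
move=> l00 kx0; have [B [d1 [B0 d10 bnd]]] := solutions_locally_bounded l00.
have p00 : close d1 p0 p0.
  by split=> [|i|i j]; rewrite subrr normr0 ltW.
have [b0B A0B x0B] := bnd _ p00.
pose g0 i := correlation p0.1.2 p0.2 x0 i 0.
have [eta eta0 etaP] : exists2 e : R, 0 < e &
    forall i, ~~ active p0 x0 i -> e <= (p0.1.1 : R) - `|g0 i|.
  apply: (finite_positive_lower_bound (P := fun i => ~~ active p0 x0 i)) => i Ji.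
  by rewrite subr_gt0 lt_neqAle Ji; case: (kx0 i).
have [C CE] : {C : R | C = 1 + 2 * m%:R * B * (1 + B)} by eexists.
have C1 : 1 <= C by rewrite CE lerDl !mulr_ge0 ?addr_ge0 // ltW.
pose K := m%:R * (B * ((1 + B) + (1 + 2 * B * C)) + (B + B * B)).
have BC0 : 0 <= B * C by apply: mulr_ge0; lra.
have BB0 : 0 <= B * B by apply: mulr_ge0; lra.
have K0 : 0 <= K.
  apply: mulr_ge0 => //; apply: addr_ge0; last by lra.
  by apply: mulr_ge0; lra.
(* The gap between fits is of the order of the square root of the distance. *)
pose t := Num.min 1 (eta / (K + 2)).
have t0 : 0 < t by rewrite lt_min ltr01 divr_gt0 //; lra.
have t1 : t <= 1 by rewrite ge_min lexx.
have Kt : (K + 2) * t <= eta.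
  by rewrite mulrC -ler_pdivlMr; [rewrite ge_min lexx orbT | lra].
exists (Num.min d1 (t ^+ 2)); first by rewrite lt_min d10 exprn_gt0.
move=> p x i pp0 kx Ji.
have /bnd[bB AB /(_ x kx) xB] : close d1 p p0.
  by apply: closeW pp0; rewrite ge_min lexx.
have {}pp0 : close (t ^+ 2) p p0 by apply: closeW pp0; rewrite ge_min lexx orbT.
have tt0 : 0 <= t ^+ 2 by exact: sqr_ge0.
have x0B' := x0B _ kx0.
have fit := fit_gap tt0 (ltW B0) pp0 AB b0B A0B x0B' kx kx0; rewrite -CE in fit.
have zB : l1norm (x - x0) <= 2 * B.
  by apply: le_trans (l1normD _ _) _; rewrite l1normN; lra.
have fa k : `|(p.2 *m (x - x0)) k 0| <= (1 + 2 * B * C) * t.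
  apply: le_trans (entry_le_l2norm _ _) _.
  rewrite -ler_sqr ?nnegrE ?l2norm_ge0 //; last first.
    by apply: mulr_ge0; lra.
  rewrite l2norm_sqr; apply: le_trans fit _; rewrite exprMn mulrAC ler_wpM2r //.
  apply: le_trans (_ : C * (2 * B) <= _).
    by rewrite ler_wpM2l //; lra.
  have := sqr_ge0 (2 * B * C); lra.
have gap := correlation_gap tt0 (ltW B0) pp0 AB b0B A0B x0B' i fa.
apply: (lasso_kkt_inactive kx).
have gapK : `|correlation p.1.2 p.2 x i 0 - g0 i| <= K * t.
  apply: le_trans gap _; rewrite /K -[X in _ <= X]mulrA ler_wpM2l //.
  have tt : t ^+ 2 <= t by rewrite expr2 ler_piMl // ltW.
  have f1 : B * t ^+ 2 <= B * t by rewrite ler_wpM2l // ltW.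
  have f2 : B * B * t ^+ 2 <= B * B * t by rewrite ler_wpM2l.
  lra.
have := etaP i Ji.
case: pp0 => /ler_normlP[hl _] _ _.
have := ler_normD (correlation p.1.2 p.2 x i 0 - g0 i) (g0 i); rewrite subrK.
have tt : t ^+ 2 <= t by rewrite expr2 ler_piMl // ltW.
lra.
Qed.

(** Near [p0] all solutions are supported on the columns active at [p0], on which
    [A] has a left inverse; so the square of [l1norm (x - x')] is at most a
    constant times the square of the l2-norm of [A *m (x - x')], which [fit_gap]
    bounds by a constant times [D * l1norm (x - x')]. *)
Lemma local_lipschitz (R : realType) (m n : nat) (p0 : param R m n) x0 :
  0 < (p0.1.1 : R) -> lasso_kkt p0 x0 -> injective_on p0.2 (active p0 x0) ->
  exists d k : R, [/\ 0 < d, 0 <= k &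
    forall p p' D x x', close d p p0 -> close d p' p0 -> 0 <= D -> close D p p' ->
      lasso_kkt p x -> lasso_kkt p' x' -> l1norm (x - x') <= k * D].
Proof.
move=> l00 kx0 inj.
have [B [d1 [B0 d10 bnd]]] := solutions_locally_bounded l00.
have [d2 d20 supp] := support_stable l00 kx0.
have [L LP] := injective_on_left_inverse inj.
pose c := \sum_i \sum_j `|L i j|.
have c0 : 0 <= c by apply: sumr_ge0 => i _; rewrite sumr_ge0.
have Lc i j : `|L i j| <= c.
  rewrite /c (bigD1 i) //= (bigD1 j) //= -addrA lerDl addr_ge0 ?sumr_ge0 // => k _.
  by rewrite sumr_ge0.
pose q := n%:R * c * m%:R.
have q0 : 0 <= q by rewrite /q !mulr_ge0.
pose d3 := (2 * q + 1)^-1.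
have d30 : 0 < d3 by rewrite /d3 invr_gt0; lra.
have qd3 : q * d3 <= 2^-1 by rewrite /d3 ler_pdivrMr; lra.
have [C CE] : {C : R | C = 1 + 2 * m%:R * B * (1 + B)} by eexists.
have C0 : 0 <= C by rewrite CE addr_ge0 // !mulr_ge0 ?addr_ge0 // ltW.
pose h := 2 * n%:R * c * m%:R.
have h0 : 0 <= h by rewrite /h !mulr_ge0.
exists (Num.min d1 (Num.min d2 d3)), (h ^+ 2 * C).
split; [by rewrite !lt_min d10 d20 | by rewrite mulr_ge0 ?sqr_ge0 | ].
move=> p p' D x x' pp0 p'p0 D0 pp' kx kx'.
have dd1 : Num.min d1 (Num.min d2 d3) <= d1 by rewrite ge_min lexx.
have dd2 : Num.min d1 (Num.min d2 d3) <= d2 by rewrite !ge_min lexx orbT.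
have dd3 : Num.min d1 (Num.min d2 d3) <= d3 by rewrite !ge_min lexx !orbT.
have [bB AB xB] := bnd _ (closeW dd1 pp0).
have [bB' AB' /(_ x' kx') xB'] := bnd _ (closeW dd1 p'p0).
have Lz : L *m (p0.2 *m (x - x')) = x - x'.
  apply: LP => i Ji; rewrite !mxE.
  rewrite (supp _ _ _ (closeW dd2 pp0) kx Ji).
  by rewrite (supp _ _ _ (closeW dd2 p'p0) kx' Ji) subrr.
have [_ _ AA0] := closeW dd3 pp0.
have z1 := left_inverse_stable c0 Lc AA0 qd3 Lz.
have fit := fit_gap D0 (ltW B0) pp' AB bB' AB' xB' kx kx'; rewrite -CE in fit.
have z2 : l1norm (x - x') <= h * l2norm (p.2 *m (x - x')).
  apply: le_trans z1 _; rewrite /h -[leRHS]mulrA ler_wpM2l ?mulr_ge0 //.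
  exact: l1norm_le_l2norm.
set z := x - x' in z2 fit *.
have z0 := l1norm_ge0 z; have [->|zn0] := eqVneq (l1norm z) 0.
  by rewrite !mulr_ge0.
have zp : 0 < l1norm z by rewrite lt_neqAle eq_sym zn0.
rewrite -(ler_pM2r zp) -expr2.
have : l1norm z ^+ 2 <= (h * l2norm (p.2 *m z)) ^+ 2.
  by rewrite ler_sqr ?nnegrE // mulr_ge0 // l2norm_ge0.
rewrite exprMn l2norm_sqr => /le_trans; apply.
apply: le_trans (ler_wpM2l (sqr_ge0 _) fit) _.
by rewrite !mulrA.
Qed.

(** * Linear independence of the active columns *)

Lemma mulmx_sum_col (R : realType) (m n : nat) (A : 'M[R]_(m, n)) (w : 'cV[R]_n) :
  A *m w = \sum_j w j 0 *: col j A.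
Proof.
apply/colP => i; rewrite mxE summxE; apply: eq_bigr => j _.
by rewrite !mxE mulrC.
Qed.

Lemma free_activeP (R : realType) (m n : nat) (A : 'M[R]_(m, n)) (J : pred 'I_n) :
  free [seq col i A | i <- enum 'I_n & J i] <-> injective_on A J.
Proof.
set s := [seq i <- enum 'I_n | J i].
have sJ i : (i \in s) = J i by rewrite mem_filter mem_enum andbT.
pose t := in_tuple s; pose X := map_tuple (fun j => col j A) t.
have Xt (i : 'I_(size s)) : X`_i = col (tnth t i) A by rewrite -tnth_nth tnth_map.
have tinj : injective (tnth t) by apply/tuple_uniqP; rewrite filter_uniq ?enum_uniq.
split=> [/(@freeP _ _ _ X) fX w wJ Aw0|inj].
  apply/colP => j; rewrite mxE; have [Jj|/wJ //] := boolP (J j).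
  have /tnthP[i ->] : j \in t by rewrite sJ.
  apply: (fX (fun i => w (tnth t i) 0)); rewrite -[RHS]Aw0 mulmx_sum_col.
  under eq_bigr do rewrite Xt.
  rewrite -(big_tuple _ _ t xpredT (fun j => w j 0 *: col j A)) /=.
  rewrite big_filter big_enum_cond /= [RHS](bigID J) /= [X in _ = _ + X]big1 ?addr0.
    by apply: eq_bigl => k.
  by move=> k /wJ ->; rewrite scale0r.
apply/(@freeP _ _ _ X) => k sum0 i.
pose w := \col_j \sum_(i | tnth t i == j) k i.
have wt : w (tnth t i) 0 = k i.
  by rewrite mxE (eq_bigl (pred1 i)) ?big_pred1_eq // => i' /=; rewrite (inj_eq tinj).
rewrite -wt (_ : w = 0) ?mxE //; apply: inj => [j Jj|].
  rewrite mxE big1 // => i' /eqP ti'; move: Jj.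
  by rewrite -ti' -sJ mem_tnth.
rewrite mulmx_sum_col -[RHS]sum0 (partition_big (tnth t) xpredT) //=.
apply: eq_bigr => j _; rewrite mxE scaler_suml; apply: eq_bigr => i' /eqP <-.
by rewrite Xt.
Qed.

Lemma condition12P (R : realType) (m n : nat) (l : R) (b : 'cV[R]_m)
    (A : 'M[R]_(m, n)) : 0 < l ->
  condition12 l b A <->
  exists2 x, lasso_kkt (l, b, A) x & injective_on A (active (l, b, A) x).
Proof.
move=> l0.
have E x : [seq col i A | i <- enum 'I_n
      & `|((col i A)^T *m (b - A *m x)) 0 0| == l]
    = [seq col i A | i <- enum 'I_n & active (l, b, A) x i].
  congr map; apply: eq_filter => i; rewrite /active /correlation /=.
  by rewrite tr_col -row_mul [in LHS]mxE.
split=> -[x kx fx]; exists x.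
- exact/(lasso_solutionsP _ _ _ l0).
- by apply/free_activeP; rewrite -E.
- exact/(lasso_solutionsP _ _ _ l0).
- by rewrite E; apply/free_activeP.
Qed.

(** * Uniformity over the compact set of parameters *)

(** For equal base points this is the local estimate. Distinct ones keep their
    neighbours at a positive distance [e], while solutions stay bounded. *)
Lemma pairwise_lipschitz (R : realType) (m n : nat) (A0 : 'M[R]_(m, n))
    (u0 u0' : R^o * 'cV[R]_m) :
  0 < u0.1 -> 0 < u0'.1 -> condition12 u0.1 u0.2 A0 ->
  exists d k : R, [/\ 0 < d, 0 <= k &
    forall p p' x x', close d p (u0, A0) -> close d p' (u0', A0) ->
      lasso_kkt p x -> lasso_kkt p' x' -> l1norm (x - x') <= k * param_dist p p'].
Proof.
move=> l0 l0' c0; have [<-|neq] := eqVneq u0 u0'.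
  move: l0 c0; case: u0 {l0'} => l b /= l0 /(condition12P _ _ l0) [x0 kx0 inj].
  have [d [k [d0 k0 H]]] := local_lipschitz (p0 := (l, b, A0)) l0 kx0 inj.
  exists d, k; split=> // p p' x x' pp0 p'p0 kx kx'.
  apply: H pp0 p'p0 _ _ kx kx'; first exact: param_dist_ge0.
  exact: close_param_dist.
have [B [d [B0 d0 H]]] := solutions_locally_bounded (p0 := (u0, A0)) l0.
have [B' [d' [B'0 d'0 H']]] := solutions_locally_bounded (p0 := (u0', A0)) l0'.
have [e e0 eP] : exists2 e : R, 0 < e & forall p p', close e p (u0, A0) ->
    close e p' (u0', A0) -> e <= param_dist p p'.
  have sep (a a' : R) (c c' : R) (e := `|a - a'| / 3) :
      `|c - a| <= e -> `|c' - a'| <= e -> e <= `|c - c'|.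
    move=> h1 h2; have h3 := ler_normD (a - c) (c - a').
    have h4 := ler_normD (c - c') (c' - a'); rewrite !addrA !subrK in h3 h4.
    rewrite distrC in h1; rewrite /e in h1 h2 *; lra.
  have [l_eq|l_neq] := eqVneq (u0.1 : R) u0'.1; last first.
    exists (`|(u0.1 : R) - u0'.1| / 3); first by rewrite divr_gt0 // normr_gt0 subr_eq0.
    move=> p p' [h _ _] [h' _ _].
    exact: le_trans (sep _ _ _ _ h h') (lambda_le_param_dist _ _).
  have /existsP[i bi] : [exists i, u0.2 i 0 != u0'.2 i 0].
    apply: contraNT neq; rewrite negb_exists => /forallP eqb.
    case: u0 u0' l_eq eqb {l0 l0' c0 H H'} => l b [l' b'] /= -> eqb.
    by apply/eqP; congr pair; apply/colP => i; apply/eqP; rewrite -[_ == _]negbK.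
  exists (`|u0.2 i 0 - u0'.2 i 0| / 3); first by rewrite divr_gt0 // normr_gt0 subr_eq0.
  move=> p p' [_ h _] [_ h' _].
  exact: le_trans (sep _ _ _ _ (h i) (h' i)) (vector_le_param_dist _ _ _).
exists (Num.min e (Num.min d d')), ((B + B') / e); split.
- by rewrite !lt_min e0 d0.
- by rewrite divr_ge0 ?addr_ge0 // ltW.
move=> p p' x x' pp0 p'p0 kx kx'.
have me : Num.min e (Num.min d d') <= e by rewrite ge_min lexx.
have md : Num.min e (Num.min d d') <= d by rewrite !ge_min lexx orbT.
have md' : Num.min e (Num.min d d') <= d' by rewrite !ge_min lexx !orbT.
have [_ _ /(_ x kx) xB] := H _ (closeW md pp0).
have [_ _ /(_ x' kx') xB'] := H' _ (closeW md' p'p0).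
have := eP _ _ (closeW me pp0) (closeW me p'p0).
rewrite -(ler_pM2l (_ : 0 < (B + B') / e)) ?divr_gt0 ?addr_gt0 //.
rewrite mulfVK ?gt_eqF //; apply: le_trans.
by apply: le_trans (l1normD _ _) _; rewrite l1normN lerD.
Qed.

(** Compactness of [U `*` U] makes the constants of [pairwise_lipschitz] uniform.
    A single parameter [k] serves both as Lipschitz constant and, through its
    inverse, as radius of the neighbourhood of [A0]: the assertion is then
    needed only for [k] near infinity. *)
Lemma uniform_lipschitz (R : realType) (m n : nat) (A0 : 'M[R]_(m, n))
    (U : set (R^o * 'cV[R]_m)) :
  compact U -> (forall u, U u -> 0 < u.1) ->
  (forall u, U u -> condition12 u.1 u.2 A0) ->
  exists2 k : R, 0 < k & forall u u' (A A' : 'M[R]_(m, n)) x x', U u -> U u' ->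
    (forall i j, `|A i j - A0 i j| <= k^-1) ->
    (forall i j, `|A' i j - A0 i j| <= k^-1) ->
    lasso_kkt (u, A) x -> lasso_kkt (u', A') x' ->
    l1norm (x - x') <= k * param_dist (u, A) (u', A').
Proof.
move=> Uc Upos Ucond.
pose P (k : R) (uu : (R^o * 'cV[R]_m) * (R^o * 'cV[R]_m)) :=
  forall (A A' : 'M[R]_(m, n)) (x x' : 'cV[R]_n),
    (forall i j, `|A i j - A0 i j| <= k^-1) ->
    (forall i j, `|A' i j - A0 i j| <= k^-1) ->
    lasso_kkt (uu.1, A) x -> lasso_kkt (uu.2, A') x' ->
    l1norm (x - x') <= k * param_dist (uu.1, A) (uu.2, A').
have /compact_near_coveringP/(_ _ (@pinfty_nbhs R) P _)/= cov := compact_setX Uc Uc.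
have UP : \forall k \near (@pinfty_nbhs R), U `*` U `<=` P k.
  apply: cov => -[u0 u0'] [/= Uu0 Uu0'].
  have [d [k [d0 k0 H]]] :=
    pairwise_lipschitz (Upos _ Uu0) (Upos _ Uu0') (Ucond _ Uu0).
  exists (ball (u0, u0') d, [set K | Num.max k d^-1 < K]).
    split; first exact: nbhsx_ballx.
    exact: (nbhs_pinfty_gt (num_real _)).
  case=> -[u u'] K [/= [/= bu bu']]; rewrite gt_max => /andP[kK dK].
  have K0 : 0 < K by rewrite (le_lt_trans k0).
  have Kd : K^-1 <= d by rewrite invf_ple ?posrE // ltW.
  have near_close (v v0 : R^o * 'cV[R]_m) (A : 'M[R]_(m, n)) : ball v0 d v ->
      (forall i j, `|A i j - A0 i j| <= K^-1) -> close d (v, A) (v0, A0).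
    move=> [vl [_ vb]] AK; split=> [|i|i j] /=; last exact: le_trans Kd.
      by rewrite distrC ltW.
    by rewrite distrC ltW //; exact: vb.
  move=> A A' x x' AK AK' kx kx'.
  have := H _ _ _ _ (near_close _ _ _ bu AK) (near_close _ _ _ bu' AK') kx kx'.
  by move/le_trans; apply; rewrite ler_wpM2r ?param_dist_ge0 // ltW.
have [k [k0 Hk]] := filter_ex (filterI (nbhs_pinfty_gt (num_real (0 : R))) UP).
by exists k => // u u' A A' x x' Uu Uu'; exact: (Hk (u, u')).
Qed.

Lemma param_dist_refl (R : realType) (m n : nat) (p : param R m n) : param_dist p p = 0.
Proof.
case: p => u A; apply/eqP; rewrite eq_le param_dist_ge0 andbT.
apply: le_trans (param_dist_matrix _ _ _) _; rewrite big1 // => i _.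
by rewrite big1 // => j _; rewrite subrr normr0.
Qed.

Lemma closed_singleton (R : realType) (n : nat) (a : 'cV[R]_n) : closed [set a].
Proof.
move=> y ya; apply/colP => i; apply/eqP/negPn/negP => yi.
have e0 : 0 < `|a i 0 - y i 0| by rewrite normr_gt0 subr_eq0 eq_sym.
have [_ [-> [_ /(_ i 0)]]] := ya _ (nbhsx_ballx y _ e0).
by rewrite /ball /= distrC ltxx.
Qed.

Lemma lipschitz_of_condition12 (R : realType) (m n : nat) (A0 : 'M[R]_(m, n))
    (U : set (R^o * 'cV[R]_m)) :
  compact U -> (forall u, U u -> 0 < u.1) ->
  (forall u, U u -> condition12 u.1 u.2 A0) ->
  exists2 V : set 'M[R]_(m, n), nbhs A0 V &
     lipschitz_multifunction (@param_dist R m n) (@lasso_solutions R m n) (U `*` V).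
Proof.
move=> Uc Upos /(uniform_lipschitz Uc Upos) [k k0 H].
exists [set A | forall i j, `|A i j - A0 i j| <= k^-1].
  apply/nbhs_ballP; exists k^-1; first by rewrite /= invr_gt0.
  by move=> A [_ bA] i j; rewrite distrC ltW //; exact: bA.
have solP u (A : 'M[R]_(m, n)) x :
    U u -> lasso_solutions (u, A) x <-> lasso_kkt (u, A) x.
  by case: u => l b /Upos l0; exact: lasso_solutionsP.
split=> [[u A] [Uu AV]|].
  have [x kx] := kkt_exists u.2 A (Upos _ Uu).
  have -> : lasso_solutions (u, A) = [set x].
    apply/seteqP; split=> [y /(solP _ _ _ Uu) ky|_ ->]; last exact/solP.
    have := H _ _ _ _ _ _ Uu Uu AV AV ky kx; rewrite param_dist_refl mulr0 => yx.
    apply/colP => i; apply/eqP; rewrite -subr_eq0 -normr_le0.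
    by have := entry_le_l1norm (y - x) i; rewrite !mxE => /le_trans; apply.
  by split; [exists x | exact: closed_singleton].
exists k; first exact: ltW.
move=> [u A] [u' A'] [Uu AV] [Uu' AV'] x' /(solP _ _ _ Uu') kx'.
have [x kx] := kkt_exists u.2 A (Upos _ Uu).
exists x; first exact/solP.
have gap := H _ _ _ _ _ _ Uu' Uu AV' AV kx' kx.
set D := param_dist _ _ in gap *.
have {}gap := le_trans (l2norm_le_l1norm _) gap.
have kD : 0 <= k * D by rewrite mulr_ge0 ?param_dist_ge0 // ltW.
have [kD0|kDn0] := eqVneq (k * D) 0.
  exists 0.
    by rewrite /l2ball /= -ler_sqr ?nnegrE ?l2norm_ge0 // l2norm_sqr dot0r expr1n.
  rewrite scaler0 addr0; apply/colP => i; apply/eqP; rewrite eq_sym -subr_eq0 -normr_le0.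
  by have := entry_le_l2norm (x' - x) i; rewrite !mxE => /le_trans; apply; rewrite -kD0.
exists ((k * D)^-1 *: (x' - x)); last by rewrite scalerA divff // scale1r subrKC.
rewrite /l2ball /= -ler_sqr ?nnegrE ?l2norm_ge0 // l2norm_sqr dotZl dotZr mulrA -expr2.
rewrite exprVn mulrC ler_pdivrMr ?exprn_gt0 ?lt_neqAle ?[0 == _]eq_sym ?kDn0 //.
by rewrite expr1n mul1r -l2norm_sqr ler_sqr ?nnegrE // l2norm_ge0.
Qed.

(** * Non-unique solutions rule out Lipschitz continuity *)

(** Monotonicity for equal parameters leaves no room for two different fits. *)
Lemma kkt_fit_unique (R : realType) (m n : nat) (l : R) (b : 'cV[R]_m)
    (A : 'M[R]_(m, n)) x y : kkt l b A x -> kkt l b A y -> A *m x = A *m y.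
Proof.
move=> kx ky; have := kkt_monotone kx ky; rewrite subrr normr0 mul0r.
rewrite /correlation -mulmxBr residual_gap !subrr mul0mx subrr sub0r mulmxN.
rewrite dotNl opprK dot_trmx => le0.
have /dot_eq0 /eqP : dot (A *m (x - y)) (A *m (x - y)) = 0.
  by apply/eqP; rewrite eq_le le0 dot_ge0.
by rewrite mulmxBr subr_eq0 => /eqP.
Qed.

Lemma kkt_same_sign (R : realType) (g l x y : R) :
  x != 0 -> g * x = l * `|x| -> 0 <= x * y -> g * y = l * `|y|.
Proof.
move=> x0 gx xy; apply: (mulIf x0); rewrite mulrAC gx -!mulrA; congr (_ * _).
case: (ltgtP x 0) x0 => [xn _|xp _|-> //].
  rewrite ltr0_norm // ler0_norm; first by rewrite mulNr mulrC mulNr.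
  by rewrite -(nmulr_rge0 _ xn).
rewrite gtr0_norm // ger0_norm; first by rewrite mulrC.
by rewrite -(pmulr_rge0 _ xp).
Qed.

(** Moving from [x] along a kernel vector [w] keeps the fit, hence the
    correlations, and stays in the solution set until a coordinate vanishes.
    One does vanish, since the correlations are orthogonal to [w]. *)
Lemma kkt_slide (R : realType) (m n : nat) (l : R) (b : 'cV[R]_m)
    (A : 'M[R]_(m, n)) (x w : 'cV[R]_n) :
  0 < l -> kkt l b A x -> A *m w = 0 -> w != 0 -> (forall i, x i 0 = 0 -> w i 0 = 0) ->
  exists x1 i, [/\ kkt l b A x1, x1 i 0 = 0 & x i 0 != 0].
Proof.
move=> l0 kx Aw w0 xw; set g := correlation b A x.
have [i0 Pi0] : exists i, x i 0 * w i 0 < 0.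
  apply/existsP; apply: contraNT w0; rewrite negb_exists => /forallP xw0.
  have gw : dot g w = l * l1norm w.
    rewrite dotE mulr_sumr; apply: eq_bigr => i _.
    have [/xw ->|xi0] := eqVneq (x i 0) 0; first by rewrite normr0 !mulr0.
    by apply: kkt_same_sign (xi0) _ _; [case: (kx i) | rewrite leNgt xw0].
  move: gw; rewrite /g /correlation dot_trmx Aw dot0r => /esym/eqP.
  rewrite mulf_eq0 gt_eqF //= => /eqP lw; apply/eqP/colP => i; apply/eqP.
  by rewrite mxE -normr_le0 -lw entry_le_l1norm.
pose P := [pred i | x i 0 * w i 0 < 0].
(* The step length is the first at which a coordinate reaches zero. *)
have [i /= Pi imin] :=
  @Order.TotalTheory.arg_minP _ _ _ i0 P (fun i => - x i 0 / w i 0) Pi0.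
have wn0 j : x j 0 * w j 0 < 0 -> w j 0 != 0.
  by apply: contraTneq => ->; rewrite mulr0 ltxx.
set t := - x i 0 / w i 0 in imin.
have t0 : 0 < t.
  have := Pi; rewrite -[x i 0]opprK -[- x i 0](mulfVK (wn0 _ Pi)) -/t mulNr.
  rewrite oppr_lt0 -mulrA pmulr_lgt0 // -expr2 exprn_even_gt0 //=.
  exact: wn0.
have AE : A *m (x + t *: w) = A *m x by rewrite mulmxDr -scalemxAr Aw scaler0 addr0.
exists (x + t *: w), i; split; first last.
- by move: Pi; apply: contraTneq => ->; rewrite mul0r ltxx.
- by rewrite !mxE /t mulfVK ?subrr // wn0.
move=> j; rewrite /correlation AE -/(correlation b A x); case: (kx j) => gl gx.
have -> : (x + t *: w) j 0 = x j 0 + t * w j 0 by rewrite !mxE.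
split=> //; have [xj|xj] := eqVneq (x j 0) 0.
  by rewrite xj (xw _ xj) mulr0 addr0 normr0 !mulr0.
apply: kkt_same_sign (xj) gx _; rewrite mulrDr -expr2 mulrCA.
have [Pj|nPj] := ltP (x j 0 * w j 0) 0; last first.
  by rewrite addr_ge0 ?sqr_ge0 // mulr_ge0 // ltW.
have := ler_wnM2r (ltW Pj) (imin j Pj).
have -> : - x j 0 / w j 0 * (x j 0 * w j 0) = - x j 0 ^+ 2.
  by field; exact: wn0.
by rewrite addrC -subr_ge0 opprK.
Qed.

Definition tilt (R : realType) (m n : nat) (A : 'M[R]_(m, n)) (r : 'cV[R]_m)
    (i : 'I_n) (e : R) : 'M[R]_(m, n) :=
  \matrix_(k, j) (A k j - (j == i)%:R * (e * r k 0)).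

Lemma mulmx_tilt (R : realType) (m n : nat) (A : 'M[R]_(m, n)) r i e
    (x : 'cV[R]_n) :
  x i 0 = 0 -> tilt A r i e *m x = A *m x.
Proof.
move=> xi; apply/colP => k; rewrite !mxE; apply: eq_bigr => j _; rewrite mxE.
by case: eqVneq => [->|_]; rewrite ?xi ?mulr0 // mul0r subr0.
Qed.

Lemma tr_tilt (R : realType) (m n : nat) (A : 'M[R]_(m, n)) r i e j :
  ((tilt A r i e)^T *m r) j 0 = (A^T *m r) j 0 - (j == i)%:R * (e * dot r r).
Proof.
rewrite !mxE dotE !mulr_sumr -sumrB; apply: eq_bigr => k _; rewrite !mxE; ring.
Qed.

(** Tilting column [i] against the residual lowers the modulus of its
    correlation below [l] and leaves [x] a solution, as its [i]-th coordinate is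
    zero. All solutions have the same fit, so that column is inactive for every
    one of them. *)
Lemma tilt_solutions_zero (R : realType) (m n : nat) (l : R) (b : 'cV[R]_m)
    (A : 'M[R]_(m, n)) x i (e : R) (r := b - A *m x) (g := correlation b A x i 0) :
  `|g| = l -> 0 < e * dot r r -> e * dot r r < 1 -> 0 < l ->
  kkt l b A x -> x i 0 = 0 ->
  forall y, kkt l b (tilt A r i (e * g)) y -> y i 0 = 0.
Proof.
move=> gl er0 er1 l0 kx xi0; set A' := tilt _ _ _ _.
have gE z : A' *m z = A *m x -> forall j, correlation b A' z j 0 =
    correlation b A x j 0 - (j == i)%:R * (e * g * dot r r).
  by move=> Az j; rewrite /correlation Az tr_tilt.
have gi : `|g - e * g * dot r r| < l.
  have -> : g - e * g * dot r r = (1 - e * dot r r) * g by ring.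
  by rewrite normrM gl gtr_pMl // gtr0_norm ?subr_gt0 // gtrBl.
have kx' : kkt l b A' x.
  move=> j; rewrite (gE x) ?mulmx_tilt //.
  case: eqVneq => [->|_]; last by rewrite mul0r subr0.
  by rewrite xi0 mulr0 normr0 mulr0 mul1r ltW.
move=> y ky; apply: (lasso_kkt_inactive ky).
by rewrite gE -?(kkt_fit_unique kx' ky) ?mulmx_tilt // eqxx mul1r.
Qed.

Lemma lipschitz_entry (R : realType) (m n : nat) (U : set (R^o * 'cV[R]_m))
    (V : set 'M[R]_(m, n)) :
  lipschitz_multifunction (@param_dist R m n) (@lasso_solutions R m n) (U `*` V) ->
  exists2 k : R, 0 <= k & forall (l : R) b A A' x', U (l, b) -> 0 < l -> V A -> V A' ->
    kkt l b A' x' -> exists2 x, kkt l b A x &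
      forall i, `|x' i 0 - x i 0| <= k * \sum_i \sum_j `|A' i j - A i j|.
Proof.
move=> [_ [k k0 H]]; exists k => // l b A A' x' Ulb l0 VA VA' kx'.
have sx' : lasso_solutions (l, b, A') x' by exact/lasso_solutionsP.
have [x sx [z z1 <-]] := H (l, b, A) (l, b, A') (conj Ulb VA) (conj Ulb VA') _ sx'.
exists x => [|i]; first exact/(lasso_solutionsP _ _ _ l0).
rewrite !mxE addrAC subrr add0r normrM ger0_norm ?mulr_ge0 ?param_dist_ge0 //.
apply: le_trans (_ : k * param_dist (l, b, A') (l, b, A) <= _).
  rewrite ler_piMr ?mulr_ge0 ?param_dist_ge0 //.
  exact: le_trans (entry_le_l2norm _ _) z1.
by rewrite ler_wpM2l // param_dist_matrix.
Qed.

(** If some solution vanishes at [i] and another one does not, an arbitrarily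
    small tilt of column [i] removes all solutions that do not vanish at [i]:
    the distance from [x] to the new solution set does not tend to 0. *)
Lemma not_lipschitz_of_slide (R : realType) (m n : nat) (U : set (R^o * 'cV[R]_m))
    (V : set 'M[R]_(m, n)) (l : R) (b : 'cV[R]_m) (A : 'M[R]_(m, n)) x x1 i :
  lipschitz_multifunction (@param_dist R m n) (@lasso_solutions R m n) (U `*` V) ->
  U (l, b) -> 0 < l -> nbhs A V -> kkt l b A x -> kkt l b A x1 ->
  x1 i 0 = 0 -> x i 0 = 0.
Proof.
move=> /lipschitz_entry[k k0 H] Ulb l0 AV kx kx1 x1i.
apply/eqP/negPn/negP => xi; have xi0 : 0 < `|x i 0| by rewrite normr_gt0.
have AE := kkt_fit_unique kx kx1.
pose r := b - A *m x1; pose g := correlation b A x1 i 0.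
have gl : `|g| = l.
  have := kx i; rewrite /correlation AE -/(correlation b A x1) -/g => -[_ gx].
  have := congr1 Num.norm gx; rewrite !normrM normr_id (gtr0_norm l0).
  exact/mulIf/lt0r_neq0.
have r0 : 0 < dot r r.
  rewrite lt_neqAle dot_ge0 andbT eq_sym; apply: contraTneq l0 => /dot_eq0 r0.
  by rewrite -gl /g /correlation -/r r0 mulmx0 mxE normr0 ltxx.
have /nbhs_ballP[d /= d0 dV] := AV.
have rn : 0 <= l1norm r by exact: l1norm_ge0.
(* [e] is small enough for the tilt to stay in [V], to keep the sign of the
   correlation, and for [k] times the change of the matrix to be less than
   [|x i|]. *)
pose Q := 1 + l * l1norm r + dot r r + k * (l * l1norm r).
pose mu := Num.min d (Num.min 1 `|x i 0|).
have mu0 : 0 < mu by rewrite !lt_min d0 ltr01 xi0.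
have q1 : 0 <= l * l1norm r by rewrite mulr_ge0 // ltW.
have q2 : 0 <= k * (l * l1norm r) by rewrite mulr_ge0.
have Q0 : 0 < Q by rewrite /Q; lra.
have [e [e0 eQ]] : exists e, 0 < e /\ forall q, q < Q -> e * q < mu.
  exists (mu / Q); split=> [|q qQ]; first by rewrite divr_gt0.
  by rewrite mulrAC ltr_pdivrMr // ltr_pM2l.
have mud : mu <= d by rewrite ge_min lexx.
have mu1 : mu <= 1 by rewrite !ge_min lexx orbT.
have mux : mu <= `|x i 0| by rewrite !ge_min lexx !orbT.
have e1 : e * dot r r < 1 by apply: lt_le_trans mu1; apply: eQ; rewrite /Q; lra.
have e2 : e * (l * l1norm r) < d by apply: lt_le_trans mud; apply: eQ; rewrite /Q; lra.
have e3 : e * (k * (l * l1norm r)) < `|x i 0|.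
  by apply: lt_le_trans mux; apply: eQ; rewrite /Q; lra.
have tilt0 := tilt_solutions_zero gl (mulr_gt0 e0 r0) e1 l0 kx1 x1i.
set A' := tilt _ _ _ _ in tilt0.
have dA s j : `|A s j - A' s j| = (j == i)%:R * (e * l * `|r s 0|).
  rewrite mxE opprB addrC subrK normrM normr_nat !normrM (gtr0_norm e0).
  by rewrite gl.
have VA' : V A'.
  apply: dV; split=> // s j; rewrite /ball /= dA.
  apply: le_lt_trans e2; apply: le_trans (_ : e * l * `|r s 0| <= _).
    by rewrite ler_piMl ?mulr_ge0 ?lern1 ?leq_b1 // ltW.
  by rewrite -mulrA ler_wpM2l ?ler_wpM2l ?entry_le_l1norm // ltW.
have [y ky /(_ i)] := H _ _ _ _ _ Ulb l0 VA' (nbhs_singleton AV) kx.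
rewrite (tilt0 _ ky) subr0 leNgt => /negP; apply; apply: le_lt_trans e3.
rewrite mulrCA ler_wpM2l // mulrA /l1norm mulr_sumr; apply: ler_sum => s _.
under eq_bigr do rewrite dA.
rewrite (bigD1 i) //= big1 ?addr0 ?eqxx ?mul1r // => j /negbTE ->.
by rewrite mul0r.
Qed.

(** * Trading a perturbation of the data vector for one of the matrix *)

Definition reflection (R : realType) (m : nat) (a : 'cV[R]_m) : 'M[R]_m :=
  1%:M - (2 / dot a a) *: (a *m a^T).

Lemma mulmx_outer (R : realType) (m : nat) (a y : 'cV[R]_m) :
  a *m a^T *m y = dot a y *: a.
Proof.
apply/colP => i; rewrite -mulmxA mxE big_ord1 !mxE mulrC.
by congr (_ * _); rewrite /dot mxE.
Qed.

Lemma reflectionE (R : realType) (m : nat) (a y : 'cV[R]_m) :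
  reflection a *m y = y - (2 * dot a y / dot a a) *: a.
Proof.
rewrite /reflection mulmxBl mul1mx -scalemxAl mulmx_outer scalerA.
by congr (_ - _ *: _); rewrite mulrAC.
Qed.

Lemma tr_reflection (R : realType) (m : nat) (a : 'cV[R]_m) :
  (reflection a)^T = reflection a.
Proof. by rewrite /reflection linearB linearZ /= trmx1 trmx_mul trmxK. Qed.

Lemma reflection_invol (R : realType) (m : nat) (a : 'cV[R]_m) :
  dot a a != 0 -> reflection a *m reflection a = 1%:M.
Proof.
move=> a0; rewrite {2}/reflection mulmxBr mulmx1 -scalemxAr mulmxA.
have -> : reflection a *m a = - a.
  by rewrite reflectionE mulfK // scaler_nat mulr2n opprD addrA subrr sub0r.
by rewrite mulNmx scalerN opprK /reflection subrK.
Qed.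

(** A multiple of a rotation that maps [b] to [b'] and is close to the identity
    when [b'] is close to [b]: the first reflection maps [b] to [- b], and the
    second one maps [- (c *: b)] to [b'], two vectors of equal length. *)
Definition similarity (R : realType) (m : nat) (b b' : 'cV[R]_m) : 'M[R]_m :=
  let c := l2norm b' / l2norm b in
  c *: (reflection (b' + c *: b) *m reflection b).

Lemma similarity_vector (R : realType) (m : nat) (b b' : 'cV[R]_m)
    (c := l2norm b' / l2norm b) :
  dot b b != 0 -> dot (b' + c *: b) (b' + c *: b) != 0 ->
  similarity b b' *m b = b'.
Proof.
move=> b0 a0; rewrite /similarity -/c -scalemxAl -mulmxA.
have -> : reflection b *m b = - b.
  by rewrite reflectionE mulfK // scaler_nat mulr2n opprD addrA subrr sub0r.
rewrite mulmxN scalerN scalemxAr reflectionE.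
have norms : dot b' b' = c ^+ 2 * dot b b.
  rewrite -!l2norm_sqr -exprMn /c mulfVK //.
  by apply: contraNneq b0 => bn; rewrite -l2norm_sqr bn expr0n.
move: a0; set a := b' + _ => a0.
have aa : dot a a = 2 * dot a (c *: b).
  by rewrite /a !(dotDl, dotDr, dotZl, dotZr) norms (dotC b b'); ring.
by rewrite -aa divff // scale1r /a opprB addrK.
Qed.

Lemma similarity_orthogonal (R : realType) (m : nat) (b b' : 'cV[R]_m)
    (c := l2norm b' / l2norm b) :
  dot b b != 0 -> dot (b' + c *: b) (b' + c *: b) != 0 ->
  similarity b b' *m (similarity b b')^T = (c ^+ 2)%:M.
Proof.
move=> b0 a0; rewrite /similarity -/c linearZ /= trmx_mul !tr_reflection.
rewrite -scalemxAl -scalemxAr scalerA -mulmxA (mulmxA (reflection b)).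
by rewrite !(reflection_invol, mul1mx) // scalemx1 expr2.
Qed.

(** Solutions for ([b'], [A]) are, up to scaling, solutions for the fixed vector
    [b] and a changed matrix: the Lasso problem is invariant under rotations. *)
Lemma kkt_similarity (R : realType) (m n : nat) (l c : R) (b b' : 'cV[R]_m)
    (M : 'M[R]_m) (A : 'M[R]_(m, n)) x :
  c != 0 -> M *m M^T = (c ^+ 2)%:M -> M *m b = b' ->
  kkt l b' A x -> kkt l b (M^T *m A) ((c ^+ 2)^-1 *: x).
Proof.
move=> c0 MM Mb kx.
have c2 : 0 < c ^+ 2 by rewrite exprn_even_gt0.
have gE : correlation b (M^T *m A) ((c ^+ 2)^-1 *: x) = correlation b' A x.
  rewrite /correlation trmx_mul trmxK -(mulmxA A^T) mulmxBr Mb; congr (_ *m (_ - _)).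
  rewrite -!scalemxAr !mulmxA MM -mulmxA mul_scalar_mx scalerA.
  by rewrite mulVf ?gt_eqF // scale1r.
move=> i; rewrite gE [(_ *: x) i 0]mxE; case: (kx i) => gl gx; split=> //.
by rewrite mulrCA gx normrM mulrCA ger0_norm // invr_ge0 ltW.
Qed.

Lemma entrywise_cvg_nbhs (R : realType) (T : Type) (F : set_system T)
    (m n : nat) (M : T -> 'M[R]_(m, n)) L (V : set 'M[R]_(m, n)) :
  Filter F -> entrywise_cvg F M L -> nbhs L V -> \forall t \near F, V (M t).
Proof.
move=> FF ML /nbhs_ballP[d /= d0 dV].
have : \forall t \near F, forall ij : 'I_m * 'I_n,
    `|L ij.1 ij.2 - M t ij.1 ij.2| < d.
  apply: filter_forall => ij.
  exact: cvgr_dist_lt (ML ij.1 ij.2) _ d0.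
by apply: filterS => t Mt; apply: dV; split=> // i j; exact: (Mt (i, j)).
Qed.

Section SimilarityConvergence.
Variables (R : realType) (T : Type) (F : set_system T) (m : nat).
Variables (b : 'cV[R]_m) (b' : T -> 'cV[R]_m).
Hypotheses (FF : Filter F) (b0 : dot b b != 0) (b'b : entrywise_cvg F b' b).
Let c t := l2norm (b' t) / l2norm b.
Let a t := b' t + c t *: b.

Lemma cvg_similarity_ratio : c t @[t --> F] --> (1 : R).
Proof.
have n0 : l2norm b != 0.
  by apply: contraNneq b0 => bn; rewrite -l2norm_sqr bn expr0n.
rewrite -(divff n0); apply: cvgM; last exact: cvg_cst.
exact: cvg_l2norm.
Qed.

Lemma cvg_similarity_axis : entrywise_cvg F a (b + 1 *: b).
Proof.
apply: entrywise_cvgD => //; apply: entrywise_cvgZ; first exact: cvg_similarity_ratio.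
exact: entrywise_cvg_cst.
Qed.

Lemma similarity_axis_neq0 : dot (b + 1 *: b) (b + 1 *: b) != 0.
Proof.
rewrite scale1r !(dotDl, dotDr); have := dot_ge0 b.
rewrite le_eqVlt eq_sym (negbTE b0) /= => bp.
by rewrite gt_eqF //; lra.
Qed.

Lemma cvg_similarity : entrywise_cvg F (fun t => similarity b (b' t)) 1%:M.
Proof.
have E : 1 *: (reflection (b + 1 *: b) *m reflection b) = 1%:M.
  rewrite scale1r -(reflection_invol b0); congr (_ *m _).
  rewrite /reflection scale1r -mulr2n -(scaler_nat 2 b); congr (_ - _).
  rewrite [(_ *: _)^T]linearZ /= -scalemxAl -scalemxAr !scalerA dotZl dotZr.
  by congr (_ *: _); field.
rewrite -E; apply: entrywise_cvgZ; first exact: cvg_similarity_ratio.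
apply: entrywise_cvg_mulmx; last exact: entrywise_cvg_cst.
apply: entrywise_cvgB; first exact: entrywise_cvg_cst.
apply: entrywise_cvgZ.
  apply: cvgM; first exact: cvg_cst.
  apply: cvgV; first exact: similarity_axis_neq0.
  by apply: cvg_dot; exact: cvg_similarity_axis.
apply: entrywise_cvg_mulmx; first exact: cvg_similarity_axis.
by apply: entrywise_cvgT; exact: cvg_similarity_axis.
Qed.
End SimilarityConvergence.

(** Adding [e] times the correlations on the active set makes every active
    coordinate non-zero, with the sign of its correlation; moving [b] by the
    image under [A] of that vector keeps the residual. *)
Lemma kkt_shift (R : realType) (m n : nat) (l e : R) (b : 'cV[R]_m)
    (A : 'M[R]_(m, n)) x
    (u := \col_i (if active (l, b, A) x i then correlation b A x i 0 else 0)) :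
  0 < l -> 0 < e -> kkt l b A x ->
  kkt l (b + e *: (A *m u)) A (x + e *: u) /\
  forall i, (x + e *: u) i 0 = 0 -> ~~ active (l, b, A) x i.
Proof.
move=> l0 e0 kx.
have gE : correlation (b + e *: (A *m u)) A (x + e *: u) = correlation b A x.
  by rewrite /correlation (mulmxDr A) -scalemxAr opprD addrACA subrr addr0.
have coord i : (x + e *: u) i 0 =
    x i 0 + e * (if active (l, b, A) x i then correlation b A x i 0 else 0).
  by rewrite !mxE.
have act i : active (l, b, A) x i ->
    correlation b A x i 0 * (x + e *: u) i 0 = l * `|x i 0| + e * l ^+ 2.
  move=> Ji; rewrite coord Ji mulrDr; case: (kx i) => _ ->; congr (_ + _).
  rewrite mulrCA -expr2; congr (_ * _).
  by rewrite -real_normK ?num_real // (eqP Ji).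
have el : 0 < e * l ^+ 2 by rewrite mulr_gt0 // exprn_gt0.
have lx i : 0 <= l * `|x i 0| by rewrite mulr_ge0 // ltW.
split=> i.
  rewrite gE; case: (kx i) => gl gx; split=> //.
  have [Ji|nJi] := boolP (active (l, b, A) x i).
    rewrite -[l in RHS](eqP Ji) -normrM ger0_norm // act //.
    by rewrite addr_ge0 // ltW.
  by rewrite coord (negbTE nJi) mulr0 addr0.
move=> xi0; apply/negP => /act; rewrite xi0 mulr0 => /eqP.
by rewrite eq_sym gt_eqF // ltr_wpDl.
Qed.

(** If a kernel vector [w] lives on the active columns, shifting [b] to [b' e]
    produces a solution whose support contains that of [w], hence, by
    [kkt_slide], several solutions. A similarity transfers this to a matrix
    near [A] with [b] unchanged, where [not_lipschitz_of_slide] applies. *)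
Lemma condition12_of_lipschitz (R : realType) (m n : nat) (A : 'M[R]_(m, n))
    (U : set (R^o * 'cV[R]_m)) (V : set 'M[R]_(m, n)) (l : R) (b : 'cV[R]_m) :
  nbhs A V ->
  lipschitz_multifunction (@param_dist R m n) (@lasso_solutions R m n) (U `*` V) ->
  U (l, b) -> 0 < l -> condition12 l b A.
Proof.
move=> AV lip Ulb l0; apply/(condition12P _ _ l0).
have [x kx] := kkt_exists b A l0; exists x => // w wJ Aw.
apply/eqP/negPn/negP => w0.
(* For [b = 0] the only solution is 0 and no column is active. *)
have b0 : dot b b != 0.
  apply: contraNneq w0 => /dot_eq0 b0; apply/eqP/colP => i; rewrite [X in _ = X]mxE.
  apply: wJ; rewrite /active /=.
  have b00 j : `|b j 0| <= 0 by rewrite b0 mxE normr0.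
  have := kkt_l1norm_le (lexx 0) b00 kx; rewrite expr0n mulr0 pmulr_rle0 // => lx.
  have -> : x = 0.
    apply/colP => j; rewrite [X in _ = X]mxE; apply/eqP; rewrite -normr_le0.
    exact: le_trans (entry_le_l1norm _ _) lx.
  by rewrite /correlation b0 mulmx0 subrr mulmx0 mxE normr0 eq_sym gt_eqF.
set u := \col_i (if active (l, b, A) x i then correlation b A x i 0 else 0).
pose b' (e : R) := b + e *: (A *m u).
pose c e := l2norm (b' e) / l2norm b.
have b'b : entrywise_cvg 0^'+ b' b.
  rewrite -[X in entrywise_cvg _ _ X]addr0 -(scale0r (A *m u)).
  apply: entrywise_cvgD; first exact: entrywise_cvg_cst.
  apply: entrywise_cvgZ; last exact: entrywise_cvg_cst.
  by apply: cvg_at_right_filter; exact: cvg_id.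
have nearV : \forall e \near 0^'+, nbhs ((similarity b (b' e))^T *m A) V.
  apply: (entrywise_cvg_nbhs (L := A) (V := V°)); last exact: nbhs_interior.
  rewrite -[X in entrywise_cvg _ _ X]mul1mx -[X in X *m A]trmx1.
  apply: entrywise_cvg_mulmx; last exact: entrywise_cvg_cst.
  by apply: entrywise_cvgT; exact: cvg_similarity.
have nearc : \forall e \near 0^'+, c e != 0.
  exact: cvgr_neq0 (cvg_similarity_ratio _ b0 b'b) (oner_neq0 _).
have neara : \forall e \near 0^'+, dot (b' e + c e *: b) (b' e + c e *: b) != 0.
  apply: cvgr_neq0 (similarity_axis_neq0 b0).
  by apply: cvg_dot; exact: cvg_similarity_axis.
have [e [[[e0 AeV] ce] ae]] := filter_ex
  (filterI (filterI (filterI (nbhs_right_gt (0 : R)) nearV) nearc) neara).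
have [kx' x'0] := kkt_shift l0 e0 kx; rewrite -/u in kx' x'0.
have kAe :=
  kkt_similarity ce (similarity_orthogonal b0 ae) (similarity_vector b0 ae) kx'.
set M := similarity b (b' e) in AeV kAe.
have c2 : (c e ^+ 2)^-1 != 0 by rewrite invr_eq0 expf_neq0.
have [||x1 [i [kx1 x1i xi]]] := kkt_slide (w := w) l0 kAe _ w0.
- by rewrite -mulmxA Aw mulmx0.
- move=> i; rewrite mxE => /eqP; rewrite mulf_eq0 (negbTE c2) /= => /eqP /x'0.
  exact: wJ.
by rewrite (not_lipschitz_of_slide lip Ulb l0 AeV kAe kx1 x1i) eqxx in xi.
Qed.

Theorem theorem4p1 (R : realType) (m n : nat) (Abar : 'M[R]_(m, n))
    (U : set (R^o * 'cV[R]_m)) (hU0 : U !=set0) (hUc : compact U)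
    (hUconv : convex_set U) (hUpos : forall u, U u -> 0 < u.1) :
  (exists2 V : set 'M[R]_(m, n), nbhs Abar V &
     lipschitz_multifunction (@param_dist R m n) (@lasso_solutions R m n)
       (U `*` V))
  <-> (forall lambda b, U (lambda, b) -> condition12 lambda b Abar).
Proof.
split=> [[V AV lip] l b Ulb|cond].
  exact: condition12_of_lipschitz AV lip Ulb (hUpos _ Ulb).
by apply: lipschitz_of_condition12 => // -[l b]; exact: cond.
Qed.
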